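(* Let $T$ be a norm on $\mathbf R^3$ with smooth Wulff shape $W=\{T=1\}$ of positive curvature, and let $X:\Sigma\to\mathbf R^3$ be a smooth immersed oriented surface with nowhere vanishing Gauss curvature, with Cahn-Hoffman field $\xi$ and anisotropic principal curvatures $\lambda_1,\lambda_2$. Among all anisotropic sphere congruences $Y$ enveloped by $X$, the anisotropic middle sphere congruence $$Z:=X+\frac12\Bigl(\frac1{\lambda_1}+\frac1{\lambda_2}\Bigr)(\xi,1)$$ is characterized by the trace condition: $\mathrm{trace}\bigl((d\xi)^{-1}(dY)^T\bigr)=0$ on $\Sigma$ if and only if $Y=Z$.
   Context: $\mathbf R^3$ is identified with $\{x\in\mathbf R^4: x_4=0\}$, so $X$ also denotes $(X,0)$. Let $\nu$ be the unit normal of $X$ such that $dX(e_1),dX(e_2),\nu$ is positively oriented for positively oriented $e_1,e_2$. The Cahn-Hoffman field $\xi:\Sigma\to W$ sends $p$ to the point of $W$ whose outward unit normal is $\nu(p)$. Hence $\mathbb T_{\xi(p)}W=dX(\mathbb T_p\Sigma)$ (as linear subspaces of $\mathbf R^3$), where $\mathbb T$ denotes tangent space. The anisotropic principal curvatures $\lambda_i$ are the real numbers with $d\xi(e_i)=-\lambda_i\,dX(e_i)$, $i=1,2$, for a basis $e_1,e_2$ of $\mathbb T_p\Sigma$; they are nonzero because the curvature of $X$ does not vanish, so $d\xi$ is invertible. The anisotropic sphere congruences $Y:\Sigma\to\mathbf R^4$ enveloped by $X$ are the maps $Y=X+\rho(\xi,1)$, $\rho$ a smooth function on $\Sigma$.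 For such $Y$, $dY(v)=(dX(v)+\rho\,d\xi(v),0)+d\rho(v)(\xi,1)$, and $(dY)^T(v):=dX(v)+\rho\,d\xi(v)\in dX(\mathbb T_p\Sigma)$ is its horizontal projection (the vertical direction being $\mathbf R(\xi,1)$). Via the isomorphism $dX:\mathbb T_p\Sigma\to dX(\mathbb T_p\Sigma)=\mathbb T_{\xi(p)}W$, both $d\xi_p$ and $(dY)^T_p$ are regarded as endomorphisms of $dX(\mathbb T_p\Sigma)$, and $(d\xi)^{-1}(dY)^T$ is their composition. *)

(* Defs.v *)
From HB Require Import structures.
From mathcomp Require Import all_boot all_order all_algebra.
From mathcomp Require Import all_classical all_reals all_analysis.

Set Implicit Arguments.
Unset Strict Implicit.
Unset Printing Implicit Defensive.

Import Order.TTheory GRing.Theory Num.Theory.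
Import numFieldNormedType.Exports.

Local Open Scope classical_set_scope.
Local Open Scope ring_scope.

(** ** Smooth maps between open sets of normed spaces *)

(* Meant for open [U]: the values of [f] outside [U] are then irrelevant. *)
Fixpoint Ck_on (R : realType) (V W : normedModType R) (k : nat)
    (U : set V) (f : V -> W) : Prop :=
  match k with
  | 0%N => forall x, U x -> {for x, continuous f}
  | k'.+1 => (forall x, U x -> differentiable f x) /\
             (forall v : V, Ck_on k' U (fun x => 'D_v f x))
  end.

Definition smooth_on (R : realType) (V W : normedModType R)
    (U : set V) (f : V -> W) : Prop := forall k, Ck_on k U f.

(** ** Oriented smooth surfaces *)

Record chart (R : realType) (S : topologicalType) := Chart {
  dom : set S;
  cod : set 'rV[R]_2;
  coord : S -> 'rV[R]_2;
  param : 'rV[R]_2 -> S;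
  dom_open : open dom;
  cod_open : open cod;
  coord_cod : forall p, dom p -> cod (coord p);
  param_dom : forall u, cod u -> dom (param u);
  coordK : forall p, dom p -> param (coord p) = p;
  paramK : forall u, cod u -> coord (param u) = u;
  coord_continuous : {within dom, continuous coord};
  param_continuous : {within cod, continuous param}
}.

Definition transition (R : realType) (S : topologicalType)
    (c c' : chart R S) : 'rV[R]_2 -> 'rV[R]_2 := coord c' \o param c.

Definition overlap (R : realType) (S : topologicalType)
    (c c' : chart R S) : set 'rV[R]_2 :=
  [set u | cod c u /\ dom c' (param c u)].

Record orientedSurface (R : realType) := OrientedSurface {
  surface_carrier :> topologicalType;
  surface_hausdorff : hausdorff_space surface_carrier;
  surface_second_countable : @second_countable surface_carrier;
  atlas : set (chart R surface_carrier);
  chart_at : surface_carrier -> chart R surface_carrier;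
  chart_at_atlas : forall p, atlas (chart_at p);
  chart_at_dom : forall p, dom (chart_at p) p;
  transition_smooth : forall c c', atlas c -> atlas c' ->
    smooth_on (overlap c c') (transition c c');
  transition_oriented : forall c c' u, atlas c -> atlas c' ->
    overlap c c' u -> 0 < \det ('J (transition c c') u)
}.

Definition smooth_map (R : realType) (S : orientedSurface R)
    (V : normedModType R) (f : S -> V) : Prop :=
  forall c, atlas c -> smooth_on (cod c) (f \o param c).

(* The tangent space of [S] at [p] is identified with ['rV_2] through the
   preferred chart at [p]; a tangent vector [v] is sent by the differential of
   [f] to [v *m diff_at f p]. Charts of the atlas being orientation-compatible,
   a basis [e1, e2] is positively oriented iff [0 < \det (col_mx e1 e2)]. *)
Definition diff_at (R : realType) (S : orientedSurface R) (n : nat)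
    (f : S -> 'rV[R]_n) (p : S) : 'M[R]_(2, n) :=
  'J (f \o param (chart_at p)) (coord (chart_at p) p).

Definition immersion (R : realType) (S : orientedSurface R)
    (X : S -> 'rV[R]_3) : Prop :=
  smooth_map X /\ forall p, row_free (diff_at X p).

(** ** Euclidean geometry of surfaces in 3-space *)

Definition dotp (R : realType) (n : nat) (u v : 'rV[R]_n) : R :=
  (u *m v^T) 0 0.

(* [A] and [B] are the matrices of linear maps [a], [b] from a plane to
   ['rV_n], where [a] is injective and the image of [b] lies in that of [a].
   Then [endo_mx A B *m A = B], i.e. [endo_mx A B] is the matrix of the
   endomorphism [b \o a^-1] of the image of [a], in the basis of the rows of
   [A] and acting on row vectors on the right. *)
Definition endo_mx (R : realType) (n : nat) (A B : 'M[R]_(2, n)) : 'M[R]_2 :=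
  B *m pinvmx A.

(* Determinant of the shape operator; the rows of [A] form a basis of the
   tangent plane, those of [B] are the derivatives of the unit normal along
   this basis. *)
Definition gauss_curvature (R : realType) (A B : 'M[R]_(2, 3)) : R :=
  \det (- endo_mx A B).

Definition unit_normal (R : realType) (S : orientedSurface R)
    (X nu : S -> 'rV[R]_3) : Prop :=
  forall p : S,
    [/\ dotp (nu p) (nu p) = 1,
        forall v : 'rV[R]_2, dotp (v *m diff_at X p) (nu p) = 0
      & forall e1 e2 : 'rV[R]_2, 0 < \det (col_mx e1 e2 : 'M[R]_2) ->
          0 < \det (col_mx (col_mx (e1 *m diff_at X p) (e2 *m diff_at X p))
                           (nu p) : 'M[R]_3)].

Definition nonvanishing_curvature (R : realType) (S : orientedSurface R)
    (X nu : S -> 'rV[R]_3) : Prop :=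
  forall p : S, gauss_curvature (diff_at X p) (diff_at nu p) != 0.

Definition gradient (R : realType) (n : nat) (F : 'rV[R]_n -> R)
    (q : 'rV[R]_n) : 'rV[R]_n :=
  \row_i 'D_(delta_mx 0 i) F q.

Definition unit_gradient (R : realType) (n : nat) (F : 'rV[R]_n -> R)
    (q : 'rV[R]_n) : 'rV[R]_n :=
  (Num.sqrt (dotp (gradient F q) (gradient F q)))^-1 *: gradient F q.

Definition defining_function (R : realType) (W U : set 'rV[R]_3)
    (F : 'rV[R]_3 -> R) : Prop :=
  [/\ open U, smooth_on U F,
      forall q, U q -> (W q <-> F q = 0)
    & forall q, U q -> gradient F q != 0].

Definition smooth_surface (R : realType) (W : set 'rV[R]_3) : Prop :=
  forall q, W q -> exists U F, defining_function W U F /\ U q.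

(* The tangent plane of [W] at [q] is the orthogonal complement of the gradient
   of any local defining function. *)
Definition positive_curvature (R : realType) (W : set 'rV[R]_3) : Prop :=
  forall U F q, defining_function W U F -> U q -> W q ->
  forall A : 'M[R]_(2, 3), row_free A -> A *m (gradient F q)^T = 0 ->
    0 < gauss_curvature A (A *m 'J (unit_gradient F) q).

(** ** Norms, Wulff shapes and anisotropic surface geometry *)

Definition is_norm (R : realType) (T : 'rV[R]_3 -> R) : Prop :=
  [/\ forall x, 0 <= T x,
      forall x, T x = 0 -> x = 0,
      forall a x, T (a *: x) = `|a| * T x
    & forall x y, T (x + y) <= T x + T y].

Definition wulff (R : realType) (T : 'rV[R]_3 -> R) : set 'rV[R]_3 :=
  [set x | T x = 1].

(* "Outward" refers to the convex body [T <= 1] bounded by [wulff T]. *)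
Definition outward_unit_normal (R : realType) (T : 'rV[R]_3 -> R)
    (q n : 'rV[R]_3) : Prop :=
  [/\ dotp n n = 1,
      forall U F, defining_function (wulff T) U F -> U q ->
        forall v, dotp v (gradient F q) = 0 -> dotp v n = 0
    & \forall t \near 0^'+, 1 < T (q + t *: n)].

Definition cahn_hoffman (R : realType) (T : 'rV[R]_3 -> R)
    (S : orientedSurface R) (nu xi : S -> 'rV[R]_3) : Prop :=
  forall p : S, wulff T (xi p) /\ outward_unit_normal T (xi p) (nu p).

Definition anisotropic_principal_curvatures (R : realType)
    (S : orientedSurface R) (X xi : S -> 'rV[R]_3)
    (lambda1 lambda2 : S -> R) : Prop :=
  forall p : S, exists e1 e2 : 'rV[R]_2,
    [/\ row_free (col_mx e1 e2),
        e1 *m diff_at xi p = - lambda1 p *: (e1 *m diff_at X p)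
      & e2 *m diff_at xi p = - lambda2 p *: (e2 *m diff_at X p)].

(* The point [(X, 0) + rho (xi, 1)] of 4-space. *)
Definition sphere_map (R : realType) (S : orientedSurface R)
    (X xi : S -> 'rV[R]_3) (rho : S -> R) (p : S) : 'rV[R]_(3 + 1) :=
  row_mx (X p) (const_mx 0) + rho p *: row_mx (xi p) (const_mx 1).

Definition anisotropic_sphere_congruence (R : realType)
    (S : orientedSurface R) (X xi : S -> 'rV[R]_3)
    (Y : S -> 'rV[R]_(3 + 1)) : Prop :=
  exists rho : S -> R, smooth_map rho /\ Y = sphere_map X xi rho.

Definition middle_sphere_congruence (R : realType) (S : orientedSurface R)
    (X xi : S -> 'rV[R]_3) (lambda1 lambda2 : S -> R) :
    S -> 'rV[R]_(3 + 1) :=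
  sphere_map X xi (fun p => 2^-1 * ((lambda1 p)^-1 + (lambda2 p)^-1)).

(* Projection of the differential of [Y] onto the horizontal 3-space along the
   line spanned by [(xi, 1)]; for [Y = (X, 0) + rho (xi, 1)] it is
   [dX + rho dxi]. *)
Definition horizontal_diff_at (R : realType) (S : orientedSurface R)
    (xi : S -> 'rV[R]_3) (Y : S -> 'rV[R]_(3 + 1)) (p : S) : 'M[R]_(2, 3) :=
  lsubmx (diff_at Y p) - rsubmx (diff_at Y p) *m xi p.

(* Trace of [(dxi)^-1 (dY)^T] as endomorphism of the image of [dX]; matrices
   act on row vectors, so the map applied first is the left factor. *)
Definition congruence_trace (R : realType) (S : orientedSurface R)
    (X xi : S -> 'rV[R]_3) (Y : S -> 'rV[R]_(3 + 1)) (p : S) : R :=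
  \tr (endo_mx (diff_at X p) (horizontal_diff_at xi Y p) *m
       invmx (endo_mx (diff_at X p) (diff_at xi p))).

(* Main.v *)
Require Import Defs.
From HB Require Import structures.
From mathcomp Require Import all_boot all_order all_algebra.
From mathcomp Require Import all_classical all_reals all_analysis.
From mathcomp Require Import ring lra.

Set Implicit Arguments.
Unset Strict Implicit.
Unset Printing Implicit Defensive.

Import Order.TTheory GRing.Theory Num.Theory.
Import numFieldNormedType.Exports.

Local Open Scope classical_set_scope.
Local Open Scope ring_scope.

(* The trace of [(dxi)^-1 (dX + rho dxi)] is [2 rho - (1/lambda1 + 1/lambda2)],
   which settles the equivalence; what remains is that the radius of [Z] is a
   smooth function and that the [lambda_i] do not vanish.

   Smoothness of [xi]: the point [xi(p)] maximizes [<., nu(p)>] on the convex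
   body [T <= 1], and positive curvature makes it the only maximizer, so [xi] is
   continuous by compactness. In a chart it solves [F(xi) = 0] and
   [<grad F(xi), d_i X> = 0] for a local defining function [F] of the Wulff
   shape; positive curvature says that the derivative of this system in [xi] is
   invertible, and a continuous solution of such a system is smooth.

   Nonvanishing of [lambda_i]: locally [nu] is a constant sign times the unit
   gradient of [F] at [xi], so the kernel of [dxi] lies in that of [dnu]. *)

(** * Differentiation of vector-valued maps *)

(** The hypotheses on [nu], [xi], [lambda1] and [lambda2] are pointwise: they contain no continuity,
    and the two curvatures may be interchanged from point to point. Only a symmetric combination can
    be expected to be smooth, so [1/lambda1 + 1/lambda2] is read as minus the trace of
    [(dxi)^-1 dX], and this trace is rewritten, through the Gram matrix of [dxi], as a rational
    expression in the derivatives of [X] and [xi] in a chart. A second obstacle is that [diff_at]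
    uses a preferred chart that may jump with the point. Regularity is therefore checked in a fixed
    chart; the transition Jacobian has positive determinant, which preserves orientation, and it
    acts on the trace by conjugation. The solution of the implicit system is given in advance, so
    only its regularity is at stake: continuity yields differentiability, and the formula for the
    derivative then raises the order step by step. Outwardness of a normal is local and one-sided;
    convexity of the body turns it into global maximality. *)

Section diff_estimates.
Context {R : realType}.
Implicit Types V W : normedModType R.

Lemma near_shift0 V (x : V) (P : set V) :
  (\forall y \near x, P y) -> \forall h \near 0, P (h + x).
Proof. by rewrite (near_shift 0); apply: filterS => h /=; rewrite subr0. Qed.

Lemma differentiable_bound V W (f : V -> W) (x : V) : differentiable f x ->
  forall e, 0 < e ->
    \forall h \near 0, `|f (h + x) - f x - 'd f x h| <= e * `|h|.
Proof.
move=> /diff_locallyP[_ /eqaddoP fE] e e0.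
have := fE _ e0; apply: filterS => h /=.
by rewrite !fctE opprD addrA.
Qed.

Lemma bound_differentiable V W (f : V -> W) (x : V) (L : {linear V -> W}) :
  continuous L ->
  (forall e, 0 < e -> \forall h \near 0, `|f (h + x) - f x - L h| <= e * `|h|) ->
  differentiable f x.
Proof.
move=> Lc fL.
have fE : f \o shift x = cst (f x) + L +o_ 0 id.
  apply/eqaddoP => e e0; have := fL _ e0; apply: filterS => h /=.
  by rewrite !fctE opprD addrA.
by apply/diff_locallyP; rewrite (diff_unique Lc fE).
Qed.

Lemma near_eq_differentiable V W (f g : V -> W) (x : V) :
  (\near x, f x = g x) -> differentiable f x -> differentiable g x.
Proof.
move=> fg df; apply: (bound_differentiable (diff_continuous df)) => e e0.
have fgx := nbhs_singleton fg.
have {}fg := near_shift0 fg.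
near=> h; rewrite -fgx -(near fg h)//.
by near: h; exact: differentiable_bound.
Unshelve. all: by end_near. Qed.

End diff_estimates.

Section row_vector_maps.
Context {R : realType}.
Implicit Types V W : normedModType R.

Lemma differentiable_fsum V W I (r : seq I) (f : I -> V -> W) x :
  (forall i, differentiable (f i) x) ->
  differentiable (fun y => \sum_(i <- r) f i y) x.
Proof.
move=> df; elim: r => [|i r IH].
  rewrite (_ : (fun _ => _) = cst 0); first exact: differentiable_cst.
  by apply/funext => y; rewrite big_nil.
rewrite (_ : (fun _ => _) = f i + (fun y => \sum_(i <- r) f i y)).
  exact: differentiableD.
by apply/funext => y; rewrite big_cons.
Qed.

Lemma differentiable_rVP V n (f : V -> 'rV[R]_n) x :
  differentiable f x <-> forall j, differentiable (fun y => f y 0 j) x.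
Proof.
split=> [df j|df].
  exact: (differentiable_comp df (differentiable_coord _ 0 j)).
rewrite (_ : f = fun y => \sum_j f y 0 j *: delta_mx 0 j); last first.
  by apply/funext => y; exact: row_sum_delta.
by apply: differentiable_fsum => j; exact: differentiableZl.
Qed.

Lemma continuous_rVP (T : topologicalType) n (f : T -> 'rV[R]_n) x :
  {for x, continuous f} <-> forall j, {for x, continuous (fun y => f y 0 j)}.
Proof.
split=> [cf j|cf].
  exact: (continuous_comp cf (@coord_continuous _ _ _ 0 j _)).
apply/cvgrPdist_le => e e0; near=> y.
rewrite /Num.Def.normr/= mx_normrE (bigmax_le _ (ltW e0))//= => -[i j] _.
rewrite !mxE/= (ord1 i); move: j; near: y; apply: filter_forall => j.
exact: ((cvgrPdist_le _ _).1 (cf j)).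
Unshelve. all: by end_near. Qed.

Lemma linear_rV_differentiable n W (L : {linear 'rV[R]_n -> W}) x :
  differentiable L x.
Proof.
rewrite (_ : (L : _ -> _) = fun v => \sum_j (v 0 j : R) *: L (delta_mx 0 j)).
  apply: differentiable_fsum => j.
  exact: (differentiableZl _ (differentiable_coord _ 0 j)).
apply/funext => v; rewrite {1}(row_sum_delta v) linear_sum.
by apply: eq_bigr => j _; rewrite linearZ.
Qed.

Lemma linear_rV_continuous n W (L : {linear 'rV[R]_n -> W}) : continuous L.
Proof. by move=> x; apply: differentiable_continuous; exact: linear_rV_differentiable. Qed.

Lemma diff_coord V n (f : V -> 'rV[R]_n) x j v : differentiable f x ->
  'd (fun y => f y 0 j) x v = 'd f x v 0 j.
Proof.
move=> df; have dfj := (differentiable_rVP f x).1 df j.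
by rewrite -(deriveE _ dfj) -(deriveE _ df) derive_mx ?mxE//; exact: diff_derivable.
Qed.

Lemma jacobianP m n (f : 'rV[R]_m -> 'rV[R]_n) x v : v *m 'J f x = 'd f x v.
Proof. by rewrite mul_rV_lin1. Qed.

Lemma jacobian_comp m n p (f : 'rV[R]_m -> 'rV[R]_n) (g : 'rV[R]_n -> 'rV[R]_p) x :
  differentiable f x -> differentiable g (f x) ->
  'J (g \o f) x = 'J f x *m 'J g (f x).
Proof.
move=> df dg; apply/row_matrixP => i.
by rewrite row_mul !rowE !jacobianP diff_comp.
Qed.

Lemma near_eq_diff V W (f g : V -> W) x v : (\near x, f x = g x) ->
  differentiable f x -> 'd f x v = 'd g x v.
Proof.
move=> fg df; have dg := near_eq_differentiable fg df.
rewrite -(deriveE v df) -(deriveE v dg); exact: near_eq_derive.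
Qed.

Lemma near_eq_jacobian m n (f g : 'rV[R]_m -> 'rV[R]_n) x :
  (\near x, f x = g x) -> differentiable f x -> 'J f x = 'J g x.
Proof.
move=> fg df; apply/row_matrixP => i.
have E v : v *m 'J f x = v *m 'J g x := etrans (jacobianP f x v)
  (etrans (near_eq_diff v fg df) (esym (jacobianP g x v))).
rewrite [LHS]rowE [RHS]rowE; exact: (E (delta_mx 0 i)).
Qed.

Lemma diff_rV n W (f : 'rV[R]_n -> W) x v : differentiable f x ->
  'd f x v = \sum_j v 0 j *: 'D_(delta_mx 0 j) f x.
Proof.
move=> df; rewrite {1}(row_sum_delta v) linear_sum; apply: eq_bigr => j _.
by rewrite linearZ deriveE.
Qed.

End row_vector_maps.

(** * Functions of class C^k *)

Section Ck.
Context {R : realType}.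
Implicit Types V W : normedModType R.

(** Each clause of [Ck_on] concerns one point of [U] at a time, with limits taken in the ambient
    space. Regularity can thus be checked on sets depending on the point, as for [xi], whose
    defining function [F] changes with the point. *)
Lemma Ck_local V W k (U : set V) (f : V -> W) :
  (forall x, U x -> exists2 U', U' x & Ck_on k U' f) -> Ck_on k U f.
Proof.
elim: k f => [|k IH] f /= h.
  by move=> x /h[U' U'x]; apply.
split=> [x /h[U' U'x [+ _]]|v]; first exact.
by apply: IH => x /h[U' U'x [_ h']]; exists U'.
Qed.

Lemma CkS V W k (U : set V) (f : V -> W) : Ck_on k.+1 U f -> Ck_on k U f.
Proof.
elim: k f => [|k IH] f [df h].
  by move=> x /df; exact: differentiable_continuous.
by split=> [//|v]; exact: IH.
Qed.

(** On an open set, equal maps have equal germs and so equal derivatives. This is what allows a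
    derivative to be replaced by its formula in the inductions on [k]. *)
Lemma Ck_eq V W k (U : set V) (f g : V -> W) : open U ->
  (forall x, U x -> f x = g x) -> Ck_on k U f -> Ck_on k U g.
Proof.
move=> oU; elim: k f g => [|k IH] f g fg /=.
  move=> h x Ux.
  have fgx : \near x, f x = g x by apply: filterS (open_nbhs_nbhs (conj oU Ux)).
  by apply: (cvg_trans (near_eq_cvg fgx)); rewrite -fg//; exact: h.
have fgx x : U x -> \near x, f x = g x.
  by move=> Ux; apply: filterS (open_nbhs_nbhs (conj oU Ux)).
move=> [df h]; split=> [x Ux|v].
  by apply: (near_eq_differentiable (fgx _ Ux)); exact: df.
by apply: IH (h v) => x Ux; apply: near_eq_derive; exact: fgx.
Qed.

Lemma Ck_cst V W k (U : set V) (a : W) : open U -> Ck_on k U (fun=> a).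
Proof.
move=> oU; elim: k a => [|k IH] a /=; first by move=> x _; exact: cst_continuous.
split=> [x _|v]; first exact: differentiable_cst.
by apply: Ck_eq (IH 0) => // x _; rewrite derive_cst.
Qed.

Lemma CkD V W k (U : set V) (f g : V -> W) : open U ->
  Ck_on k U f -> Ck_on k U g -> Ck_on k U (fun x => f x + g x).
Proof.
move=> oU; elim: k f g => [|k IH] f g /=.
  by move=> hf hg x Ux; apply: cvgD; [exact: hf|exact: hg].
move=> [df hf] [dg hg]; split=> [x Ux|v].
  exact: differentiableD (df _ Ux) (dg _ Ux).
apply: Ck_eq (IH _ _ (hf v) (hg v)) => // x Ux.
by rewrite deriveD//; apply: diff_derivable; [exact: df|exact: dg].
Qed.

Lemma Ck_sum V W k (U : set V) I (r : seq I) (P : pred I) (f : I -> V -> W) :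
  open U -> (forall i, P i -> Ck_on k U (f i)) ->
  Ck_on k U (fun x => \sum_(i <- r | P i) f i x).
Proof.
move=> oU hf; elim: r => [|i r IH].
  by apply: (@Ck_eq V W k U (fun=> 0)) => [//|x _|]; [rewrite big_nil|exact: Ck_cst].
case: (boolP (P i)) => Pi.
  by apply: Ck_eq (CkD oU (hf _ Pi) IH) => // x _; rewrite big_cons Pi.
by apply: Ck_eq IH => // x _; rewrite big_cons (negbTE Pi).
Qed.

Lemma CkM V k (U : set V) (f g : V -> R) : open U ->
  Ck_on k U f -> Ck_on k U g -> Ck_on k U (fun x => f x * g x).
Proof.
move=> oU; elim: k f g => [|k IH] f g.
  by move=> hf hg x Ux; apply: cvgM; [exact: hf|exact: hg].
move=> hf hg; move: (CkS hf) (CkS hg) => f' g'.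
case: hf hg => df hf [dg hg]; split=> [x Ux|v].
  exact: differentiableM (df _ Ux) (dg _ Ux).
apply: Ck_eq (CkD oU (IH _ _ f' (hg v)) (IH _ _ g' (hf v))) => // x Ux.
by rewrite deriveM//; apply: diff_derivable; [exact: df|exact: dg].
Qed.

Lemma Ck_prod V k (U : set V) I (r : seq I) (P : pred I) (f : I -> V -> R) :
  open U -> (forall i, P i -> Ck_on k U (f i)) ->
  Ck_on k U (fun x => \prod_(i <- r | P i) f i x).
Proof.
move=> oU hf; elim: r => [|i r IH].
  by apply: (@Ck_eq V R k U (fun=> 1)) => [//|x _|]; [rewrite big_nil|exact: Ck_cst].
case: (boolP (P i)) => Pi.
  by apply: Ck_eq (CkM oU (hf _ Pi) IH) => // x _; rewrite big_cons Pi.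
by apply: Ck_eq IH => // x _; rewrite big_cons (negbTE Pi).
Qed.

Lemma CkV V k (U : set V) (f : V -> R) : open U ->
  (forall x, U x -> f x != 0) -> Ck_on k U f -> Ck_on k U (fun x => (f x)^-1).
Proof.
move=> oU f0; elim: k => [|k IH] hf.
  by move=> x Ux; apply: cvgV; [exact: f0|exact: hf].
have hV := IH (CkS hf).
case: hf => df hf; split=> [x Ux|v].
  by apply: differentiableV; [exact: df|exact: f0].
have hN1 : Ck_on k U (fun=> -1 : R) by exact: Ck_cst.
apply: Ck_eq (CkM oU (CkM oU hN1 (CkM oU hV hV)) (hf v)) => // x Ux.
rewrite deriveV; [|exact: f0|by apply: diff_derivable; exact: df].
by rewrite mulN1r -invfM.
Qed.

Lemma Ck_linear V W k (U : set V) (L : {linear V -> W}) : open U ->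
  continuous L -> Ck_on k U L.
Proof.
move=> oU cL; case: k => [|k]; first by move=> x _; exact: cL.
split=> [x _|v]; first exact: linear_differentiable.
apply: Ck_eq (Ck_cst k (L v) oU) => // x _.
by rewrite deriveE ?diff_lin//; exact: linear_differentiable.
Qed.

Lemma Ck_coord V n k (U : set V) (f : V -> 'rV[R]_n) j : open U ->
  Ck_on k U f -> Ck_on k U (fun x => f x 0 j).
Proof.
move=> oU; elim: k f => [|k IH] f.
  by move=> hf x /hf /continuous_rVP.
move=> [df hf]; split=> [x /df/differentiable_rVP//|v].
apply: Ck_eq (IH _ (hf v)) => // x Ux.
by rewrite derive_mx ?mxE//; apply: diff_derivable; exact: df.
Qed.

Lemma Ck_rV V n k (U : set V) (f : V -> 'rV[R]_n) : open U ->
  (forall j, Ck_on k U (fun x => f x 0 j)) -> Ck_on k U f.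
Proof.
move=> oU; elim: k f => [|k IH] f hf.
  by move=> x Ux; apply/continuous_rVP => j; exact: (hf j).
have df x : U x -> differentiable f x.
  by move=> Ux; apply/differentiable_rVP => j; have [+ _] := hf j; exact.
split=> [//|v]; apply: IH => j; have [_ /(_ v)] := hf j.
by apply: Ck_eq => // x Ux; rewrite derive_mx ?mxE//; exact: diff_derivable (df x Ux).
Qed.

Lemma Ck_comp V n k (U : set V) (O : set 'rV[R]_n) (f : V -> 'rV[R]_n)
    (g : 'rV[R]_n -> R) : open U -> open O -> (forall x, U x -> O (f x)) ->
  Ck_on k U f -> Ck_on k O g -> Ck_on k U (g \o f).
Proof.
move=> oU oO UO; elim: k g => [|k IH] g.
  by move=> hf hg x Ux; apply: continuous_comp; [exact: hf|exact/hg/UO].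
move=> hf; have f' := CkS hf; case: hf => df hf [dg hg].
split=> [x Ux|v].
  by apply: differentiable_comp; [exact: df|exact/dg/UO].
(* The direction ['D_v f x] moves with [x], while the induction hypothesis handles derivatives of
   [g] in fixed directions; expanding along the coordinate vectors separates the two. *)
pose h x := \sum_j 'D_v f x 0 j * ('D_(delta_mx 0 j) g \o f) x.
have hk : Ck_on k U h.
  apply: Ck_sum => // j _; apply: CkM => //; last exact: (IH _ f' (hg _)).
  exact: Ck_coord (hf v).
apply: Ck_eq hk => // x Ux.
have dgfx : differentiable g (f x) by exact/dg/UO.
rewrite deriveE; last by apply: differentiable_comp => //; exact: df.
rewrite diff_comp//; last exact: df.
by rewrite /= diff_rV// /h deriveE//; exact: df.
Qed.

Lemma Ck_det V n k (U : set V) (M : V -> 'M[R]_n) : open U ->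
  (forall i j, Ck_on k U (fun x => M x i j)) -> Ck_on k U (fun x => \det (M x)).
Proof.
move=> oU hM; apply: Ck_sum => // s _.
by apply: CkM => //; [exact: Ck_cst|exact: Ck_prod].
Qed.

Lemma Ck_invmx V n k (U : set V) (M : V -> 'M[R]_n) : open U ->
  (forall x, U x -> M x \in unitmx) ->
  (forall i j, Ck_on k U (fun x => M x i j)) ->
  forall i j, Ck_on k U (fun x => invmx (M x) i j).
Proof.
move=> oU uM hM i j.
(* Cramer's rule: the entry of the adjugate is the transposed cofactor, hence the exchanged
   indices. *)
pose h x := (\det (M x))^-1 * ((-1) ^+ (j + i) * \det (row' j (col' i (M x)))).
have hk : Ck_on k U h.
  apply: CkM => //.
    apply: CkV (Ck_det oU hM) => // x /uM; by rewrite unitmxE unitfE.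
  apply: CkM; [exact: oU|exact: Ck_cst|apply: Ck_det => // a b].
  by apply: Ck_eq (hM (lift j a) (lift i b)) => // x _; rewrite !mxE.
apply: Ck_eq hk => // x Ux.
by rewrite /invmx uM// !mxE.
Qed.

Lemma Ck_mulmx V m n p k (U : set V) (M : V -> 'M[R]_(m, n)) (N : V -> 'M[R]_(n, p)) :
  open U -> (forall i j, Ck_on k U (fun x => M x i j)) ->
  (forall i j, Ck_on k U (fun x => N x i j)) ->
  forall i j, Ck_on k U (fun x => (M x *m N x) i j).
Proof.
move=> oU hM hN i j.
apply: Ck_eq (@Ck_sum _ _ k U _ _ xpredT (fun l x => M x i l * N x l j) oU _) => //.
  by move=> x _; rewrite mxE.
by move=> l _; apply: CkM.
Qed.

Lemma Ck_jacobian m n k (U : set 'rV[R]_m) (f : 'rV[R]_m -> 'rV[R]_n) i j :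
  open U -> smooth_on U f -> Ck_on k U (fun x => 'J f x i j).
Proof.
move=> oU sf; have [df /(_ (delta_mx 0 i)) hf] := sf k.+1.
apply: Ck_eq (Ck_coord j oU hf) => // x Ux.
by rewrite (deriveE _ (df _ Ux)) -jacobianP -rowE [LHS]mxE.
Qed.

End Ck.

(** * Smoothness of implicit functions *)

Section implicit_function.
Context {R : realType}.

Lemma row_mx_norm_le m n (h : 'rV[R]_m) (k : 'rV[R]_n) :
  `|row_mx h k| <= `|h| + `|k|.
Proof.
rewrite [leLHS]/Num.Def.normr/= mx_normrE bigmax_le ?addr_ge0//= => -[i j] _.
rewrite mxE (ord1 i) /=; case: splitP => l _.
  rewrite (@le_trans _ _ `|h|) ?lerDl//.
  rewrite [leRHS]/Num.Def.normr/= mx_normrE; exact: (le_bigmax _ _ (0, l)).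
rewrite (@le_trans _ _ `|k|) ?lerDr//.
rewrite [leRHS]/Num.Def.normr/= mx_normrE; exact: (le_bigmax _ _ (0, l)).
Qed.

Section row_mx_maps.
Variables (V : normedModType R) (m n : nat) (f : V -> 'rV[R]_m) (g : V -> 'rV[R]_n).

Lemma row_mx_coordl j : (fun y => row_mx (f y) (g y) 0 (lshift n j)) = (fun y => f y 0 j).
Proof. by apply/funext => y; rewrite row_mxEl. Qed.

Lemma row_mx_coordr j : (fun y => row_mx (f y) (g y) 0 (rshift m j)) = (fun y => g y 0 j).
Proof. by apply/funext => y; rewrite row_mxEr. Qed.

Lemma Ck_row_mx k (U : set V) : open U -> Ck_on k U f -> Ck_on k U g ->
  Ck_on k U (fun x => row_mx (f x) (g x)).
Proof.
move=> oU hf hg; apply: Ck_rV => //; move=> i; case: (split_ordP i) => j ->.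
  by rewrite row_mx_coordl; exact: Ck_coord.
by rewrite row_mx_coordr; exact: Ck_coord.
Qed.

Lemma differentiable_row_mx x : differentiable f x -> differentiable g x ->
  differentiable (fun x => row_mx (f x) (g x)) x.
Proof.
move=> df dg; apply: (differentiable_rVP _ _).2; move=> i; case: (split_ordP i) => j ->.
  by rewrite row_mx_coordl; exact: (differentiable_rVP f x).1.
by rewrite row_mx_coordr; exact: (differentiable_rVP g x).1.
Qed.

Lemma diff_row_mx x v : differentiable f x -> differentiable g x ->
  'd (fun x => row_mx (f x) (g x)) x v = row_mx ('d f x v) ('d g x v).
Proof.
move=> df dg; have dfg := differentiable_row_mx df dg.
apply/rowP => i; case: (split_ordP i) => j ->.
  rewrite row_mxEl -(diff_coord _ _ df); apply: etrans (esym (diff_coord _ _ dfg)) _.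
  by rewrite row_mx_coordl.
rewrite row_mxEr -(diff_coord _ _ dg); apply: etrans (esym (diff_coord _ _ dfg)) _.
by rewrite row_mx_coordr.
Qed.

End row_mx_maps.

Variables (m n : nat) (f : 'rV[R]_m -> 'rV[R]_n) (G : 'rV[R]_(m + n) -> 'rV[R]_n).

Let gph u := row_mx u (f u).

Lemma jacobian_row_mx z (h : 'rV[R]_m) (k : 'rV[R]_n) :
  'd G z (row_mx h k) = h *m usubmx ('J G z) + k *m dsubmx ('J G z).
Proof. by rewrite -jacobianP -{1}(vsubmxK ('J G z)) mul_row_col. Qed.

(** For an increment [h] of [u] and the resulting increment [k] of [f], the equation gives
    [h A + k M = o(|h| + |k|)], so [k] is [- h A M^-1] up to such an error. Continuity of [f] makes
    [k] small enough for the expansion to apply; the [|k|] in the error is then absorbed. *)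
Lemma implicit_differentiable u : {for u, continuous f} ->
  differentiable G (gph u) -> (\forall u' \near u, G (gph u') = 0) ->
  dsubmx ('J G (gph u)) \in unitmx -> differentiable f u.
Proof.
set z := gph u; set M := dsubmx _; set A := usubmx ('J G z).
move=> cf dG G0 uM.
pose L : {linear 'rV[R]_m -> 'rV[R]_n} := mulmxr (- (A *m invmx M)).
have [C C0 hC] := linear_lipschitz (@linear_rV_continuous R n _ (mulmxr (invmx M))).
have [D D0 hD] := linear_lipschitz (@linear_rV_continuous R m _ L).
apply: (bound_differentiable (@linear_rV_continuous R m _ L)) => e e0.
(* The first bound gives [C * d <= 1/2], which absorbs [|k|] and yields [|k| <= (1 + 2 * D) * |h|];
   the second then bounds the error [C * d * (|h| + |k|)] by [e * |h|]. *)
pose d := Num.min (2 * C)^-1 (e / (C * (2 + 2 * D))).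
have d0 : 0 < d.
  by rewrite lt_min invr_gt0 divr_gt0// mulr_gt0// addr_gt0// mulr_gt0.
have /nbhs_norm0P[r /= r0 hr] := differentiable_bound dG d0.
have r20 : 0 < r / 2 by rewrite divr_gt0.
have cf0 : \forall h \near (0 : 'rV[R]_m), `|f (h + u) - f u| < r / 2.
  have cfr : \forall v \near u, `|f u - f v| < r / 2 by exact: (cvgrPdist_lt _ _).1 cf _ r20.
  by apply: filterS (near_shift0 cfr) => h /=; rewrite distrC.
have G00 := near_shift0 G0.
have h0 : \forall h \near (0 : 'rV[R]_m), `|h| < r / 2.
  by apply/nbhs_norm0P; exists (r / 2).
have Gz : G z = 0 by exact: (nbhs_singleton G0).
near=> h; set k := f (h + u) - f u.
have hk : gph (h + u) = row_mx h k + z by rewrite /gph add_row_mx subrK.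
have : `|row_mx h k| < r.
  rewrite (le_lt_trans (row_mx_norm_le _ _))// (splitr r).
  by apply: ltrD; [exact: (near h0 h)|exact: (near cf0 h)].
move=> /hr /=; rewrite -hk (near G00 h)// Gz subrr sub0r normrN jacobian_row_mx -/A -/M.
move=> hb.
have kE : k - L h = (h *m A + k *m M) *m invmx M.
  by rewrite mulmxDl -(mulmxA k) mulmxV// mulmx1 /L /= mulmxN opprK mulmxA addrC.
have b1 : `|k - L h| <= C * (d * (`|h| + `|k|)).
  rewrite kE (le_trans (hC _))// ler_pM2l// (le_trans hb)//.
  by rewrite ler_pM2l// row_mx_norm_le.
have Cd : C * d <= 2^-1.
  rewrite (@le_trans _ _ (C * (2 * C)^-1))//; first by rewrite ler_pM2l// ge_min lexx.
  by rewrite invfM mulrCA divff ?mulr1 ?gt_eqF.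
have Cde : C * d * (2 + 2 * D) <= e.
  rewrite mulrAC -ler_pdivlMl; last by rewrite mulr_gt0// addr_gt0// mulr_gt0.
  by rewrite mulrC ge_min lexx orbT.
have kL : `|k| <= `|k - L h| + `|L h| by rewrite -{1}(subrK (L h) k) ler_normD.
have Cdk : C * d * (`|h| + `|k|) <= 2^-1 * (`|h| + `|k|).
  by rewrite ler_wpM2r ?addr_ge0.
have {}hDh := hD h; move: b1 kL hDh Cdk.
have := normr_ge0 h.
rewrite mulrA; move: (`|k - L h|) (`|L h|) (`|h|) (`|k|) => a b x y x0 aE yE bE sE.
have yD : y <= (1 + 2 * D) * x by lra.
rewrite (le_trans aE)// (@le_trans _ _ (C * d * ((2 + 2 * D) * x)))//.
  by rewrite ler_pM2l ?mulr_gt0//; lra.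
by rewrite mulrA ler_wpM2r.
Unshelve. all: by end_near. Qed.

(** Bootstrap: differentiating [G (u, f u) = 0] expresses ['D_v f] through the Jacobian of [G] along
    the graph of [f]. If [f] is of class C^k, so is this expression, and [f] is of class C^(k+1). *)
Lemma implicit_smooth (U : set 'rV[R]_m) (O : set 'rV[R]_(m + n)) :
  open U -> open O -> smooth_on O G ->
  (forall u, U u -> {for u, continuous f}) ->
  (forall u, U u -> O (gph u)) ->
  (forall u, U u -> G (gph u) = 0) ->
  (forall u, U u -> dsubmx ('J G (gph u)) \in unitmx) ->
  smooth_on U f.
Proof.
move=> oU oO sG cf UO G0 uM.
have dG z : O z -> differentiable G z by have [+ _] := sG 1%N; exact.
have df u : U u -> differentiable f u.
  move=> Uu; apply: implicit_differentiable; [exact: cf|exact/dG/UO| |exact: uM].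
  by apply: filterS (open_nbhs_nbhs (conj oU Uu)) => v /G0.
have Ckgph k : Ck_on k U f -> Ck_on k U gph.
  apply: Ck_row_mx => //.
  by apply: (@Ck_linear _ _ _ k U idfun) => // x; exact: cvg_id.
have CkJ k : Ck_on k U f -> forall i j, Ck_on k U (fun u => 'J G (gph u) i j).
  move=> hf i j.
  exact: (Ck_comp oU oO UO (Ckgph _ hf) (Ck_jacobian k i j oO sG)).
have DfE v u : U u -> 'D_v f u =
    - (v *m usubmx ('J G (gph u)) *m invmx (dsubmx ('J G (gph u)))).
  move=> Uu; rewrite deriveE//; last exact: df.
  have dgu : differentiable gph u by exact: differentiable_row_mx (df _ Uu).
  have dGu := dG _ (UO _ Uu).
  have : 'd (G \o gph) u v = 0.
    have cst0 : \near u, (cst 0 : _ -> 'rV[R]_n) u = (G \o gph) u.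
      by apply: filterS (open_nbhs_nbhs (conj oU Uu)) => y /G0 /= ->.
    rewrite -(near_eq_diff v cst0) ?diff_cst//; exact: differentiable_cst.
  have di : is_diff u (@idfun 'rV[R]_m) idfun by exact: is_diff_id.
  have gE : 'd gph u v = row_mx v ('d f u v).
    apply: etrans (diff_row_mx v (@ex_diff _ _ _ _ _ _ _ di) (df _ Uu)) _.
    by congr (row_mx _ _); rewrite (@diff_val _ _ _ _ _ _ _ di).
  move=> dGg.
  have compE : 'd (G \o gph) u v = 'd G (gph u) ('d gph u v).
    exact: (congr1 (fun F : 'rV[R]_m -> 'rV[R]_n => F v) (diff_comp dgu dGu)).
  have : v *m usubmx ('J G (gph u)) + 'd f u v *m dsubmx ('J G (gph u)) = 0.
    apply: etrans (esym (jacobian_row_mx (gph u) v ('d f u v))) _.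
    exact: etrans (congr1 ('d G (gph u)) (esym gE)) (etrans (esym compE) dGg).
  move=> /eqP.
  rewrite addrC addr_eq0 => /eqP /(congr1 (mulmxr (invmx (dsubmx ('J G (gph u)))))) /=.
  by rewrite (mulmxK (uM _ Uu)) mulNmx.
elim=> [|k IH]; first exact: cf.
split=> [//|v].
have hk : Ck_on k U (fun u =>
    - (v *m usubmx ('J G (gph u)) *m invmx (dsubmx ('J G (gph u))))).
  apply: Ck_rV => // j.
  apply: (@Ck_eq _ _ _ k U (fun u => - 1 * (v *m usubmx ('J G (gph u)) *m
    invmx (dsubmx ('J G (gph u)))) 0 j)) => //.
    by move=> u _; rewrite mulN1r [RHS]mxE.
  apply: CkM => //; first exact: Ck_cst.
  apply: Ck_mulmx => //.
    apply: Ck_mulmx => //; first by move=> a b; exact: Ck_cst.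
    by move=> a b; apply: Ck_eq (CkJ k IH (lshift n a) b) => // u _; rewrite [RHS]mxE.
  apply: Ck_invmx => // a b.
  by apply: Ck_eq (CkJ k IH (rshift m a) b) => // u _; rewrite [RHS]mxE.
by apply: Ck_eq hk => // u Uu; rewrite DfE.
Qed.

End implicit_function.

(** * Level sets and maximizers of linear forms *)

Section dot_product.
Context {R : realType} {n : nat}.
Implicit Types u v w : 'rV[R]_n.

Lemma dotpE u v : dotp u v = \sum_i u 0 i * v 0 i.
Proof. by rewrite /dotp mxE; apply: eq_bigr => i _; rewrite mxE. Qed.

Lemma dotpC u v : dotp u v = dotp v u.
Proof. by rewrite !dotpE; apply: eq_bigr => i _; rewrite mulrC. Qed.

Lemma dotpDl u v w : dotp (u + v) w = dotp u w + dotp v w.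
Proof. by rewrite /dotp mulmxDl mxE. Qed.

Lemma dotpZl a u v : dotp (a *: u) v = a * dotp u v.
Proof. by rewrite /dotp -scalemxAl mxE. Qed.

Lemma dotp0l v : dotp 0 v = 0.
Proof. by rewrite /dotp mul0mx mxE. Qed.

Lemma dotpNl u v : dotp (- u) v = - dotp u v.
Proof. by rewrite -scaleN1r dotpZl mulN1r. Qed.

Lemma dotpBl u v w : dotp (u - v) w = dotp u w - dotp v w.
Proof. by rewrite dotpDl dotpNl. Qed.

Lemma dotpZr a u v : dotp u (a *: v) = a * dotp u v.
Proof. by rewrite dotpC dotpZl dotpC. Qed.

Lemma dotpBr u v w : dotp u (v - w) = dotp u v - dotp u w.
Proof. by rewrite dotpC dotpBl !(dotpC _ u). Qed.

Lemma dotp_mulmx m (x : 'rV[R]_m) (A : 'M[R]_(m, n)) v :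
  dotp (x *m A) v = \sum_i x 0 i * dotp (row i A) v.
Proof.
rewrite /dotp -mulmxA mxE; apply: eq_bigr => i _.
by rewrite -row_mul [in RHS]mxE.
Qed.

Lemma dotp_ge0 u : 0 <= dotp u u.
Proof. by rewrite dotpE; apply: sumr_ge0 => i _; rewrite -expr2 sqr_ge0. Qed.

Lemma dotp_eq0 u : (dotp u u == 0) = (u == 0).
Proof.
apply/eqP/eqP => [|->]; last by rewrite dotp0l.
rewrite dotpE => /psumr_eq0P u0; apply/rowP => i.
by apply/eqP; rewrite mxE -sqrf_eq0 expr2 u0// => j _; rewrite -expr2 sqr_ge0.
Qed.

Lemma dotp_gt0 u : (0 < dotp u u) = (u != 0).
Proof. by rewrite lt_def dotp_eq0 dotp_ge0 andbT. Qed.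

Lemma coord_norm_le u i : `|u 0 i| <= `|u|.
Proof. rewrite [leRHS]/Num.Def.normr/= mx_normrE; exact: (le_bigmax _ _ (0, i)). Qed.

Lemma dotp_norm_le u v : `|dotp u v| <= n%:R * `|u| * `|v|.
Proof.
rewrite dotpE (le_trans (ler_norm_sum _ _ _))//.
rewrite (@le_trans _ _ (\sum_(i < n) `|u| * `|v|))//.
  by apply: ler_sum => i _; rewrite normrM ler_pM// coord_norm_le.
by rewrite sumr_const card_ord -[leLHS]mulr_natl mulrA.
Qed.

(* Subtracting from [u] its component along [v] shows that [u] is a multiple of
   [v] as soon as everything orthogonal to [v] is orthogonal to [u]. *)
Lemma orthogonal_colinear u v : v != 0 ->
  (forall w, dotp w v = 0 -> dotp w u = 0) -> exists a, u = a *: v.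
Proof.
rewrite -dotp_gt0 => v0 uv; exists (dotp u v / dotp v v).
apply/eqP; rewrite -subr_eq0 -dotp_eq0; apply/eqP.
set w := u - _; have wv : dotp w v = 0.
  by rewrite dotpBl dotpZl divfK ?subrr// gt_eqF.
by rewrite {2}/w dotpBr dotpZr wv mulr0 subr0 uv.
Qed.

End dot_product.

Section dot_product_differential.
Context {R : realType} {V : normedModType R} {n : nat}.

Lemma differentiable_dotp (f g : V -> 'rV[R]_n) x :
  differentiable f x -> differentiable g x ->
  differentiable (fun y => dotp (f y) (g y)) x.
Proof.
move=> df dg; rewrite (_ : (fun _ => _) = fun y => \sum_i f y 0 i * g y 0 i).
  apply: differentiable_fsum => i.
  apply: differentiableM; first exact: (differentiable_rVP f x).1.
  exact: (differentiable_rVP g x).1.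
by apply/funext => y; rewrite dotpE.
Qed.

Lemma derive_coord (f : V -> 'rV[R]_n) x v i : differentiable f x ->
  'D_v (fun y => f y 0 i) x = 'D_v f x 0 i.
Proof. by move=> df; rewrite derive_mx ?mxE//; exact: diff_derivable. Qed.

Lemma derive_dotp (f g : V -> 'rV[R]_n) x v :
  differentiable f x -> differentiable g x ->
  'D_v (fun y => dotp (f y) (g y)) x = dotp ('D_v f x) (g x) + dotp (f x) ('D_v g x).
Proof.
move=> df dg.
rewrite (_ : (fun _ => _) = \sum_(i < n) (fun y => f y 0 i * g y 0 i)); last first.
  by apply/funext => y; rewrite fct_sumE dotpE.
have dfi i : derivable (fun y => f y 0 i) x v.
  by apply: diff_derivable; exact: (differentiable_rVP f x).1.
have dgi i : derivable (fun y => g y 0 i) x v.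
  by apply: diff_derivable; exact: (differentiable_rVP g x).1.
rewrite derive_sum; last by move=> i; exact: derivableM.
rewrite !dotpE -big_split; apply: eq_bigr => i _ /=.
by rewrite deriveM// -(derive_coord _ _ df) -(derive_coord _ _ dg) addrC [g x 0 i *: _]mulrC.
Qed.

End dot_product_differential.

Lemma diff_gradient {R : realType} n (F : 'rV[R]_n -> R) q v :
  differentiable F q -> 'd F q v = dotp v (gradient F q).
Proof. by move=> dF; rewrite diff_rV// dotpE; apply: eq_bigr => i _; rewrite mxE. Qed.

Section level_sets.
Context {R : realType} {n : nat}.
Variables (F : 'rV[R]_n -> R) (U : set 'rV[R]_n) (q : 'rV[R]_n).
Hypotheses (oU : open U) (dF : forall x, U x -> differentiable F x).
Hypotheses (Uq : U q) (Fq : F q = 0) (gq : gradient F q != 0).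

(* Along the segment [q + t v + s g], [|s| <= e t], [F] changes sign. *)
Lemma level_set_tangent v e : dotp v (gradient F q) = 0 -> 0 < e ->
  exists2 d, 0 < d & forall t, 0 < t < d -> exists s,
    [/\ `|s| <= e * t, U (q + (t *: v + s *: gradient F q))
      & F (q + (t *: v + s *: gradient F q)) = 0].
Proof.
set g := gradient F q => vg e0.
have g0 : 0 < dotp g g by rewrite dotp_gt0.
pose B := `|v| + e * `|g| + 1.
have B0 : 0 < B by rewrite ltr_wpDl// addr_ge0// mulr_ge0// ltW.
(* With this [h] the first-order error [h * (t * B)] is half of [e * t * dotp g g], the size of the
   linear term at [s = e * t] and [s = - (e * t)], so it cannot change the sign of [F] there. *)
pose h := e * dotp g g / (2 * B).
have h0 : 0 < h by rewrite divr_gt0 ?mulr_gt0.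
have nF := differentiable_bound (dF Uq) h0.
have nU : \forall x \near (0 : 'rV[R]_n), U (x + q).
  exact: (near_shift0 (open_nbhs_nbhs (conj oU Uq))).
have /nbhs_norm0P[r /= r0 hr] : \forall y \near (0 : 'rV[R]_n),
    `|F (y + q) - F q - 'd F q y| <= h * `|y| /\ U (y + q) by exact: filterI.
exists (r / B) => [|t /andP[t0 tr]]; first exact: divr_gt0.
have small s : `|s| <= e * t -> `|t *: v + s *: g| <= t * B.
  move=> se; rewrite (le_trans (ler_normD _ _))// !normrZ (gtr0_norm t0).
  have := ler_wpM2r (normr_ge0 g) se.
  by rewrite /B; move: (`|v|) (`|g|) (`|s|) => a b c; lra.
have tB : t * B < r by rewrite -ltr_pdivlMr.
have inU s : `|s| <= e * t -> U (q + (t *: v + s *: g)).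
  move=> /small/le_lt_trans/(_ tB)/hr[_]; by rewrite addrC.
have est s : `|s| <= e * t ->
    `|F (q + (t *: v + s *: g)) - s * dotp g g| <= h * (t * B).
  move=> /[dup] /small hs /small/le_lt_trans/(_ tB)/hr[+ _].
  rewrite (diff_gradient _ (dF Uq)) Fq subr0 dotpDl !dotpZl vg mulr0 add0r.
  by rewrite [_ + q]addrC => /le_trans; apply; rewrite ler_pM2l.
have hB : h * (t * B) = e * t * dotp g g / 2.
  by rewrite /h; field; rewrite gt_eqF.
have et0 : 0 < e * t by exact: mulr_gt0.
have etg0 : 0 < e * t * dotp g g by exact: mulr_gt0.
pose phi s := F (q + (t *: v + s *: g)).
have pos : 0 <= phi (e * t).
  have := est (e * t); rewrite hB (gtr0_norm et0) lexx => /(_ isT).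
  by rewrite ler_norml => /andP[+ _]; rewrite -/(phi _); lra.
have neg : phi (- (e * t)) <= 0.
  have := est (- (e * t)); rewrite hB normrN (gtr0_norm et0) lexx => /(_ isT).
  by rewrite ler_norml => /andP[_]; rewrite -/(phi _); lra.
have cphi : {within `[- (e * t), e * t], continuous phi}.
  apply: continuous_in_subspaceT => s; rewrite inE/= in_itv/= -ler_norml => se.
  have cs : {for s, continuous (fun s : R => q + (t *: v + s *: g))}.
    apply: cvgD; first exact: cvg_cst.
    apply: cvgD; first exact: cvg_cst.
    exact: scalel_continuous.
  exact: (continuous_comp cs (differentiable_continuous (dF (inU _ se)))).
have := IVT _ cphi (v := 0); case.
- by rewrite (le_trans (ltW _) (ltW et0))// oppr_lt0.
- by rewrite ge_min neg le_max pos orbT.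
move=> s; rewrite in_itv/= -ler_norml => se Fs; exists s; split=> //.
exact: inU.
Qed.

End level_sets.

Section argmax.
Context {R : realType} {n : nat} {X : topologicalType}.
Variables (K : set 'rV[R]_n) (c f : X -> 'rV[R]_n) (u : X).
Hypothesis closedK : closed K.
Hypothesis convexK : forall x y t, K x -> K y -> 0 <= t <= 1 -> K (x + t *: (y - x)).

(** By uniqueness and compactness, [dotp (y - q) (c u)] is at most some [- M < 0] on the points [y]
    of [K] at distance [e] from [q = f u]. If [f u'] were at distance at least [e], the segment from
    [q] to it would contain such a [y] with [dotp (y - q) (c u') >= 0], which is impossible once
    [c u'] is close to [c u]. *)
Lemma argmax_continuous : {for u, continuous c} ->
  (\forall u' \near u, K (f u') /\ forall y, K y -> dotp y (c u') <= dotp (f u') (c u')) ->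
  (forall y, K y -> dotp y (c u) = dotp (f u) (c u) -> y = f u) ->
  {for u, continuous f}.
Proof.
move=> cc fmax uniq; have [Kq qmax] := nbhs_singleton fmax.
set q := f u in Kq qmax uniq *.
apply/cvgrPdist_lt => e e0.
pose S := K `&` [set y | `|q - y| = e].
have cn : continuous (fun y : 'rV[R]_n => `|q - y|).
  move=> y; have cs : {for y, continuous (fun y : 'rV[R]_n => q - y)}.
    apply: differentiable_continuous; apply: (@differentiableB _ _ _ (cst q) idfun).
      exact: differentiable_cst.
    exact: linear_rV_differentiable.
  exact: (continuous_comp cs (@norm_continuous _ _ _)).
have compS : compact S.
  apply: bounded_closed_compact.
    exists (`|q| + e); split; first exact: num_real.
    move=> M hM y [_ /= ye]; rewrite (le_trans _ (ltW hM))// -ye.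
    by rewrite -{1}(subKr q y) ler_normB.
  apply: closedI => //.
  rewrite (_ : [set y | _] = (fun y : 'rV[R]_n => `|q - y|) @^-1` [set e])//.
  by apply: closed_comp => [y _|]; [exact: cn|exact: closed_eq].
have [M M0 hM] : exists2 M, 0 < M & forall y, S y -> dotp (y - q) (c u) <= - M.
  have [S0|/set0P S0] := eqVneq S set0; first by exists 1 => // y; rewrite S0.
  have cd : continuous (fun y : 'rV[R]_n => dotp y (c u)).
    move=> y; apply: differentiable_continuous.
    by apply: differentiable_dotp => //; exact: differentiable_cst.
  have [z /set_mem[Kz ze] zmax] := compact_EVT_max S0 compS (continuous_subspaceT cd).
  exists (dotp q (c u) - dotp z (c u)) => [|y Sy]; last first.
    by rewrite dotpBl opprB lerD2r; apply: zmax; exact/mem_set.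
  rewrite subr_gt0 lt_neqAle qmax// andbT; apply/eqP => /(uniq _ Kz) zq.
  by move: ze e0; rewrite /= zq subrr normr0 => <-; rewrite ltxx.
have cu : \forall u' \near u, n%:R * e * `|c u - c u'| < M.
  have n1 : 0 < n%:R * e + 1 by rewrite ltr_wpDl// mulr_ge0// ltW.
  have hc : \forall u' \near u, `|c u - c u'| < M / (n%:R * e + 1).
    by apply: (cvgrPdist_lt _ _).1 cc _ _; exact: divr_gt0.
  apply: filterS hc => u' hc.
  rewrite (le_lt_trans _ (_ : (n%:R * e + 1) * `|c u - c u'| < M))//.
    by rewrite ler_wpM2r// lerDl.
  by rewrite mulrC -ltr_pdivlMr.
apply: filterS2 cu fmax => u' cu' [Kf fm]; rewrite ltNge; apply/negP; rewrite distrC => ef.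
have d0 : 0 < `|f u' - q| by exact: lt_le_trans ef.
pose y := q + (e / `|f u' - q|) *: (f u' - q).
have Sy : S y.
  split.
    apply: convexK => //; rewrite divr_ge0 ?(ltW e0)//=.
    by rewrite ler_pdivrMr// mul1r.
  rewrite /= /y opprD addrA subrr sub0r normrN normrZ.
  by rewrite gtr0_norm ?divr_gt0// divfK ?gt_eqF.
have yq : `|y - q| = e by rewrite distrC; case: Sy.
have := hM _ Sy; have : 0 <= dotp (y - q) (c u').
  rewrite /y addrC addKr dotpZl mulr_ge0 ?divr_ge0 ?(ltW e0)//.
  by rewrite dotpBl subr_ge0 fm.
have : `|dotp (y - q) (c u - c u')| < M.
  by rewrite (le_lt_trans (dotp_norm_le _ _))// yq.
by rewrite dotpBr ltr_norml => /andP[+ _]; lra.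
Qed.

End argmax.

Lemma sgr_eq_of_mul_gt0 {R : realDomainType} (x y : R) : 0 < x * y -> Num.sg x = Num.sg y.
Proof.
have [x0|x0|->] := ltrgtP x 0; last by rewrite mul0r ltxx.
  by rewrite nmulr_rgt0// => y0; rewrite !ltr0_sg.
by rewrite pmulr_rgt0// => y0; rewrite !gtr0_sg.
Qed.

Lemma mul_gt0_of_dist_lt {R : realFieldType} (x y : R) : `|x - y| < `|x| -> 0 < x * y.
Proof.
case: (ltrgt0P x) => [x0|x0|->]; last by rewrite normr_lt0.
  by rewrite ltr_norml => /andP[? ?]; rewrite pmulr_rgt0//; lra.
by rewrite ltr_norml => /andP[? ?]; rewrite nmulr_rgt0//; lra.
Qed.

Lemma lipschitz_bound_continuous {R : realType} (V W : normedModType R) (f : V -> W) C :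
  0 <= C -> (forall x y, `|f x - f y| <= C * `|x - y|) -> continuous f.
Proof.
move=> C0 fC x; apply/cvgrPdist_lt => e e0.
have C1 : 0 < C + 1 by rewrite ltr_wpDl.
have hy : \forall y \near x, `|x - y| < e / (C + 1).
  by apply/nbhs_normP; exists (e / (C + 1)) => //=; exact: divr_gt0.
apply: filterS hy => y; rewrite ltr_pdivlMr// => xy.
rewrite (le_lt_trans (fC _ _))// (le_lt_trans _ xy)// mulrC.
by rewrite ler_wpM2l// lerDl.
Qed.

(** Constancy on one side is enough because the differential at [x] is already known to exist: a
    nonzero ['d f x v] would dominate the remainder at small [t > 0]. *)
Lemma diff_eq0_ray {R : realType} (V W : normedModType R) (f : V -> W) x v d :
  differentiable f x -> 0 < d -> (forall t, 0 < t < d -> f (t *: v + x) = f x) ->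
  'd f x v = 0.
Proof.
move=> df d0 fx; apply/eqP/negPn/negP; rewrite -normr_gt0 => dv0.
have v1 : 0 < `|v| + 1 by rewrite ltr_wpDl.
have e0 : 0 < `|'d f x v| / (2 * (`|v| + 1)) by rewrite divr_gt0 ?mulr_gt0.
have /nbhs_norm0P[r /= r0 hr] := differentiable_bound df e0.
pose t := Num.min (d / 2) (r / (`|v| + 1)).
have t0 : 0 < t by rewrite lt_min !divr_gt0.
have tr : `|t *: v| < r.
  rewrite normrZ (gtr0_norm t0) (@lt_le_trans _ _ (t * (`|v| + 1)))//.
    by rewrite ltr_pM2l// ltrDl.
  by rewrite -ler_pdivlMr// ge_min lexx orbT.
have td : t < d by rewrite gt_min ltr_pdivrMr// mulr_natr mulr2n ltrDl d0.
have := hr _ tr; rewrite /= fx ?t0// subrr sub0r normrN linearZ /= !normrZ (gtr0_norm t0).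
rewrite mulrCA ler_pM2l// -mulrA -[leLHS]mulr1 ler_pM2l// ler_pdivlMl ?mulr_gt0// mulr1.
by have := normr_ge0 v; lra.
Qed.

(** * Unit normal fields of level sets *)

Section unit_gradients.
Context {R : realType} {n : nat}.
Variables (F : 'rV[R]_n -> R) (U : set 'rV[R]_n).
Hypotheses (oU : open U) (sF : smooth_on U F).

Lemma gradient_smooth : smooth_on U (gradient F).
Proof.
move=> k; apply: Ck_rV => // j.
have [_ /(_ (delta_mx 0 j))] := sF k.+1.
by apply: Ck_eq => // x _; rewrite mxE.
Qed.

Lemma gradient_differentiable x : U x -> differentiable (gradient F) x.
Proof. by have [+ _] := gradient_smooth 1%N; exact. Qed.

Lemma unit_gradient_colinear x m a : dotp m m = 1 -> gradient F x = a *: m ->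
  unit_gradient F x = Num.sg a *: m.
Proof.
move=> m1 gE; rewrite /unit_gradient gE dotpZl dotpZr m1 mulr1 -expr2 sqrtr_sqr.
rewrite scalerA; have [->|a0] := eqVneq a 0; first by rewrite mulr0 sgr0.
by rewrite {2}(numEsg a) mulrCA mulVf ?mulr1// normr_eq0.
Qed.

Lemma unit_gradient_unit x : gradient F x != 0 ->
  dotp (unit_gradient F x) (unit_gradient F x) = 1.
Proof.
rewrite -dotp_gt0 => g0; rewrite dotpZl dotpZr mulrA -expr2 exprVn sqr_sqrtr ?ltW//.
by rewrite mulVf ?gt_eqF.
Qed.

Lemma inv_norm_gradient_differentiable x : U x -> gradient F x != 0 ->
  differentiable (fun y => (Num.sqrt (dotp (gradient F y) (gradient F y)))^-1) x.
Proof.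
move=> Ux; rewrite -dotp_gt0 => g0; have dg := gradient_differentiable Ux.
apply: differentiableV; last by rewrite gt_eqF// sqrtr_gt0.
apply: (@differentiable_comp _ _ _ _ (fun y => dotp (gradient F y) (gradient F y)) Num.sqrt).
  exact: differentiable_dotp.
by apply/derivable1_diffP; apply: ex_derive; exact: is_derive1_sqrt.
Qed.

Lemma unit_gradient_differentiable x : U x -> gradient F x != 0 ->
  differentiable (unit_gradient F) x.
Proof.
move=> Ux g0; have dr := inv_norm_gradient_differentiable Ux g0.
apply: (differentiable_rVP _ _).2 => j.
rewrite (_ : (fun _ => _) = (fun y => (Num.sqrt (dotp (gradient F y) (gradient F y)))^-1) *
    (fun y => gradient F y 0 j)).
  apply: differentiableM => //.
  exact: (differentiable_rVP _ _).1 (gradient_differentiable Ux) j.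
by apply/funext => y; rewrite [LHS]mxE.
Qed.

(* [dN(w)] is a multiple of [N], and it is orthogonal to [N] because [N] is a
   unit vector field. *)
Lemma unit_gradient_derive_eq0 x w c : (forall y, U y -> gradient F y != 0) -> U x ->
  'D_w (gradient F) x = c *: gradient F x -> 'D_w (unit_gradient F) x = 0.
Proof.
move=> g0 Ux gE; have dN := unit_gradient_differentiable Ux (g0 _ Ux).
have dg := gradient_differentiable Ux.
have dr := inv_norm_gradient_differentiable Ux (g0 _ Ux).
set N := unit_gradient F x.
have [a DE] : exists a, 'D_w (unit_gradient F) x = a *: gradient F x.
  set r := fun y => _ in dr.
  exists (r x * c + 'D_w r x); apply/rowP => j.
  rewrite -(derive_coord _ _ dN).
  rewrite (_ : (fun _ => _) = r * (fun y => gradient F y 0 j)); last first.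
    by apply/funext => y; rewrite [LHS]mxE.
  rewrite deriveM; [|exact: diff_derivable|]; last first.
    by apply: diff_derivable; exact: (differentiable_rVP _ _).1 dg j.
  rewrite (derive_coord _ _ dg) gE !mxE /GRing.scale /=; ring.
have : dotp ('D_w (unit_gradient F) x) N + dotp N ('D_w (unit_gradient F) x) = 0.
  rewrite -(derive_dotp _ dN dN).
  have N1 : \near x, dotp (unit_gradient F x) (unit_gradient F x) = (cst 1 : _ -> R) x.
    by apply: filterS (open_nbhs_nbhs (conj oU Ux)) => y /g0 /unit_gradient_unit.
  by rewrite (near_eq_derive w N1) derive_cst.
rewrite DE (dotpC N) dotpZl -mulr2n => /eqP; rewrite mulrn_eq0 /= mulf_eq0.
have -> : (dotp (gradient F x) N == 0) = false.
  have gx := g0 _ Ux; rewrite /N dotpZr mulf_eq0 dotp_eq0 (negbTE gx) orbF.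
  by rewrite invr_eq0 gt_eqF// sqrtr_gt0 dotp_gt0.
by rewrite orbF => /eqP ->; rewrite scale0r.
Qed.

End unit_gradients.

(** Keeping [r] a variable lets the height of [row_base B] become the literal [2] without a cast
    between matrix types. *)
Lemma rank_row_base {R : fieldType} m n r (B : 'M[R]_(m, n)) : \rank B = r ->
  exists2 A : 'M[R]_(r, n), row_free A & (A :=: B)%MS.
Proof. by move=> <-; exists (row_base B); [exact: row_base_free|exact: eq_row_base]. Qed.

Lemma plane_basis {R : fieldType} (g : 'rV[R]_3) : g != 0 -> exists A : 'M[R]_(2, 3),
  [/\ row_free A, A *m g^T = 0 & forall v : 'rV_3, v *m g^T = 0 -> (v <= A)%MS].
Proof.
move=> g0; have rk : \rank (kermx g^T) = 2%N by rewrite mxrank_ker mxrank_tr rank_rV g0.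
have [A fA AE] := rank_row_base rk.
exists A; split=> //; first by apply/sub_kermxP; rewrite AE.
by move=> v vg; rewrite AE; apply/sub_kermxP.
Qed.

Lemma gauss_curvature_eq0 {R : realType} (A B : 'M[R]_(2, 3)) (v : 'rV[R]_2) :
  v != 0 -> v *m B = 0 -> gauss_curvature A B = 0.
Proof.
move=> v0 vB; apply/eqP/det0P; exists v => //.
by rewrite mulmxN mulmxA vB mul0mx oppr0.
Qed.

(** The form in which positive curvature is used: a nonzero tangent vector along which the unit
    normal is stationary would make the shape operator singular and its determinant zero. *)
Lemma curvature_nondegenerate {R : realType} (W U : set 'rV[R]_3) F q w :
  positive_curvature W -> defining_function W U F -> U q -> W q ->
  dotp w (gradient F q) = 0 -> 'D_w (unit_gradient F) q = 0 -> w = 0.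
Proof.
move=> hW WUF Uq Wq wg Dw; have [oU sF _ g0] := WUF.
have dN := unit_gradient_differentiable oU sF Uq (g0 _ Uq).
have [A [fA Ag sA]] := plane_basis (g0 _ Uq).
have /submxP[v wv] : (w <= A)%MS.
  by apply: sA; apply/rowP => i; rewrite (ord1 i) [RHS]mxE.
apply/eqP/negPn/negP => w0.
have v0 : v != 0 by apply: contraNneq w0 => v0; rewrite wv v0 mul0mx.
have := hW _ _ _ WUF Uq Wq _ fA Ag; rewrite (gauss_curvature_eq0 _ v0) ?ltxx//.
by rewrite mulmxA -wv -deriveEjacobian.
Qed.

(** * Wulff shapes *)

Section wulff_shapes.
Context {R : realType}.
Variable T : 'rV[R]_3 -> R.
Hypothesis hT : is_norm T.

Let T_ge0 x : 0 <= T x. Proof. by case: hT. Qed.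
Let TZ a x : T (a *: x) = `|a| * T x. Proof. by case: hT. Qed.
Let TD x y : T (x + y) <= T x + T y. Proof. by case: hT. Qed.
Let T_gt0 x : x != 0 -> 0 < T x.
Proof.
by case: hT => _ T0 _ _ x0; rewrite lt_def T_ge0 andbT; apply: contraNneq x0 => /T0 ->.
Qed.

Lemma norm_unit_ball_convex x y t : T x <= 1 -> T y <= 1 -> 0 <= t <= 1 ->
  T (x + t *: (y - x)) <= 1.
Proof.
move=> Tx Ty /andP[t0 t1].
have -> : x + t *: (y - x) = (1 - t) *: x + t *: y.
  by apply/rowP => i; rewrite !mxE; ring.
rewrite (le_trans (TD _ _))// !TZ (ger0_norm t0) ger0_norm ?subr_ge0//.
by nra.
Qed.

Lemma norm_unit_ball_closed : closed [set x | T x <= 1].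
Proof.
(* Continuity of [T] has to be derived from the norm axioms; [C] is a Lipschitz constant of [T] for
   the sup norm of coordinates. *)
pose C := \sum_(j < 3) T (delta_mx 0 j).
have TC x : T x <= C * `|x|.
  have -> : T x = T (\sum_j x 0 j *: delta_mx 0 j) by rewrite -row_sum_delta.
  rewrite /C mulr_suml.
  elim/big_ind2 : _ => [|a b c d ab cd|j _].
  - by rewrite -(scale0r 0) TZ normr0 mul0r.
  - by rewrite (le_trans (TD _ _))// lerD.
  - by rewrite TZ mulrC ler_wpM2l// coord_norm_le.
have C0 : 0 <= C by apply: sumr_ge0.
have cT : continuous T.
  apply: (lipschitz_bound_continuous C0) => a b.
  have TB x y : T x - T y <= C * `|x - y|.
    by rewrite lerBlDr (le_trans _ (lerD (TC _) (lexx _)))// -{1}(subrK y x) TD.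
  by rewrite ler_norml TB andbT lerNl opprB distrC TB.
rewrite (_ : [set x | _] = T @^-1` [set r | r <= 1])//.
by apply: closed_comp => [x _|]; [exact: cT|exact: closed_le].
Qed.

(** A defining function may be positive on either side of the surface, so the sign of [a] is not
    determined. *)
Lemma outward_normal_gradient U F q m :
  defining_function (wulff T) U F -> U q -> outward_unit_normal T q m ->
  exists2 a, a != 0 & gradient F q = a *: m.
Proof.
move=> WUF Uq [m1 hm _]; have [_ _ _ g0] := WUF.
have [b mE] := orthogonal_colinear (g0 _ Uq) (hm _ _ WUF Uq).
have b0 : b != 0.
  apply: contra_eq_neq m1 => b0.
  by rewrite mE b0 scale0r dotp0l eq_sym oner_eq0.
by exists b^-1; [rewrite invr_eq0|rewrite mE scalerA mulVf// scale1r].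
Qed.

(** Lagrange multiplier condition. A tangent [v] with [dotp v m > 0] would produce points of [W]
    near [q + t *: v] at which the linear form exceeds its maximum; applying this to [v] and [- v]
    gives equality. *)
Lemma maximizer_gradient (W U : set 'rV[R]_3) F q m :
  defining_function W U F -> U q -> W q ->
  (forall y, W y -> dotp y m <= dotp q m) ->
  forall v, dotp v (gradient F q) = 0 -> dotp v m = 0.
Proof.
move=> [oU sF WF g0] Uq Wq qm.
have dF x : U x -> differentiable F x by have [+ _] := sF 1%N; exact.
suff le0 v : dotp v (gradient F q) = 0 -> dotp v m <= 0.
  move=> v vg; apply/eqP; rewrite eq_le le0//= -oppr_le0 -dotpNl le0//.
  by rewrite dotpNl vg oppr0.
move=> vg; rewrite leNgt; apply/negP => a0.
set g := gradient F q in vg; set a := dotp v m in a0.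
have k1 : 0 < `|dotp g m| + 1 by rewrite ltr_wpDl.
(* At [t = d / 2] this slope keeps the correction [s * dotp g m] below half of the gain [t * a]; the
   [+ 1] covers [dotp g m = 0]. *)
have e0 : 0 < a / (2 * (`|dotp g m| + 1)) by rewrite divr_gt0 ?mulr_gt0.
have [d d0 hd] := level_set_tangent oU dF Uq ((WF _ Uq).1 Wq) (g0 _ Uq) vg e0.
have [|s [hs Us Fs]] := hd (d / 2).
  by rewrite divr_gt0//= ltr_pdivrMr// mulr_natr mulr2n ltrDl.
have := qm _ ((WF _ Us).2 Fs); rewrite !dotpDl !dotpZl -/g -/a gerDl.
have t0 : 0 < d / 2 by rewrite divr_gt0.
have sg : `|s * dotp g m| <= d / 2 * a / 2.
  rewrite normrM (le_trans (ler_wpM2r _ hs))//.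
  rewrite (_ : d / 2 * a / 2 = a / (2 * (`|dotp g m| + 1)) * (d / 2) * (`|dotp g m| + 1)).
    by apply: ler_wpM2l; [exact/ltW/mulr_gt0|rewrite lerDl].
  by field; rewrite gt_eqF.
have : 0 < d / 2 * a by exact: mulr_gt0.
move: sg; rewrite ler_norml => /andP[+ _]; lra.
Qed.

Hypothesis hWs : smooth_surface (wulff T).

(** If [b = dotp (y - q) m] were positive, [w = b *: m - (y - q)] would be tangent at [q]. The body
    contains [q + t *: (y - q)] and a point of the Wulff shape close to [q + t *: w]; in their
    midpoint the components along [y - q] cancel, leaving [q + tau *: m] with [tau > 0]. By
    convexity [T <= 1] there, against outwardness. *)
Lemma outward_normal_max q m : wulff T q -> outward_unit_normal T q m ->
  forall y, T y <= 1 -> dotp y m <= dotp q m.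
Proof.
move=> Wq qm y Ty; have [U [F [WUF Uq]]] := hWs Wq.
have [a a0 gE] := outward_normal_gradient WUF Uq qm.
have [m1 _ out] := qm; have [oU sF WF g0] := WUF.
have dF x : U x -> differentiable F x by have [+ _] := sF 1%N; exact.
rewrite leNgt; apply/negP; rewrite -subr_gt0 -dotpBl.
set v := y - q; set b := dotp v m => b0.
pose w := b *: m - v.
have wg : dotp w (gradient F q) = 0.
  by rewrite gE dotpZr dotpBl dotpZl m1 mulr1 subrr mulr0.
have k1 : 0 < `|a| + 1 by rewrite ltr_wpDl.
have e0 : 0 < b / (2 * (`|a| + 1)) by rewrite divr_gt0 ?mulr_gt0.
have [d d0 hd] := level_set_tangent oU dF Uq ((WF _ Uq).1 Wq) (g0 _ Uq) wg e0.
move: out; rewrite near_withinE => /nbhs_norm0P[r /= r0 hr].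
(* The three bounds keep [q + t *: (y - q)] on the segment to [y], [t] in the range where the level
   set is reached, and [tau] below the radius [r] of outwardness. *)
pose t := Num.min 1 (Num.min (d / 2) (r / (2 * b))).
have t0 : 0 < t by rewrite !lt_min ltr01 !divr_gt0// mulr_gt0.
have t1 : t <= 1 by rewrite ge_min lexx.
have td : t < d.
  by rewrite !gt_min (_ : d / 2 < d) ?orbT// ltr_pdivrMr// mulr_natr mulr2n ltrDl.
have tr : t * b <= r / 2.
  rewrite -ler_pdivlMr// !ge_min (_ : r / 2 / b = r / (2 * b)) ?lexx ?orbT//.
  by rewrite invfM mulrA.
have [|s [hs Us Fs]] := hd t; first by rewrite t0.
have {Fs}Ws : T (q + (t *: w + s *: gradient F q)) <= 1 by rewrite ((WF _ Us).2 Fs).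
have Tv : T (q + t *: (y - q)) <= 1.
  by apply: norm_unit_ball_convex; rewrite ?Wq// (ltW t0).
pose tau := (t * b + s * a) / 2.
have sa : `|s * a| <= t * b / 2.
  rewrite normrM (le_trans (ler_wpM2r _ hs))//.
  rewrite (_ : t * b / 2 = b / (2 * (`|a| + 1)) * t * (`|a| + 1)).
    by apply: ler_wpM2l; [exact/ltW/mulr_gt0|rewrite lerDl].
  by field; rewrite gt_eqF.
have tb : 0 < t * b by exact: mulr_gt0.
move: sa; rewrite ler_norml => /andP[sa1 sa2].
have tau0 : 0 < tau by rewrite /tau; lra.
have := hr tau; rewrite /= gtr0_norm// => /(_ _ tau0).
have taur : tau < r by rewrite /tau; lra.
move=> /(_ taur); apply/negP; rewrite -leNgt.
have -> : q + tau *: m = (q + t *: (y - q)) +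
    2^-1 *: ((q + (t *: w + s *: gradient F q)) - (q + t *: (y - q))).
  by rewrite gE /tau /w /v; apply/rowP => i; rewrite !mxE; field.
by apply: norm_unit_ball_convex => //; rewrite invr_ge0 ler0n invf_le1 ?ler1n.
Qed.

(** The maximum over the body is at least the value at the normalized vector [m / T m], which is
    positive. *)
Lemma outward_normal_pos q m : wulff T q -> outward_unit_normal T q m -> 0 < dotp q m.
Proof.
move=> Wq qm; have [m1 _ _] := qm.
have m0 : m != 0 by rewrite -dotp_gt0 m1.
have Tm := T_gt0 m0.
apply: lt_le_trans (outward_normal_max Wq qm (y := (T m)^-1 *: m) _).
  by rewrite dotpZl m1 mulr1 invr_gt0.
by rewrite TZ gtr0_norm ?invr_gt0// mulVf ?gt_eqF.
Qed.

Hypothesis hWc : positive_curvature (wulff T).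

(* If [y] were another maximizer, so would be every point of the segment from
   [q] to [y]; the unit normal would be constant along this segment, which lies
   in the Wulff shape. *)
Lemma outward_normal_max_unique q m : wulff T q -> outward_unit_normal T q m ->
  forall y, T y <= 1 -> dotp y m = dotp q m -> y = q.
Proof.
move=> Wq qm y Ty ym; have [U [F [WUF Uq]]] := hWs Wq.
have [m1 _ _] := qm; have [oU sF WF g0] := WUF.
have qmax := outward_normal_max Wq qm; have qpos := outward_normal_pos Wq qm.
set v := y - q.
have vm : dotp v m = 0 by rewrite dotpBl ym subrr.
have Wx t : 0 <= t <= 1 -> wulff T (t *: v + q).
  move=> t01; have T1 : T (t *: v + q) <= 1.
    by rewrite addrC norm_unit_ball_convex// Wq.
  have xm : dotp (t *: v + q) m = dotp q m by rewrite dotpDl dotpZl vm mulr0 add0r.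
  have x0 : t *: v + q != 0.
    by apply: contraTneq qpos => x0; rewrite -xm x0 dotp0l ltxx.
  suff : T (t *: v + q) = 1 by [].
  (* A maximizer with [T < 1] could be scaled up to the boundary; as [dotp q m > 0], this would
     exceed the maximum. *)
  apply/eqP; rewrite eq_le T1 leNgt; apply/negP => Tlt.
  have := qmax ((T (t *: v + q))^-1 *: (t *: v + q)).
  have Tx0 := T_gt0 x0; have iT0 : 0 < (T (t *: v + q))^-1 by rewrite invr_gt0.
  rewrite TZ (gtr0_norm iT0) (mulVf (lt0r_neq0 Tx0)) lexx => /(_ isT).
  rewrite dotpZl xm -[leRHS]mul1r ler_pM2r// invf_le1//.
  by rewrite leNgt Tlt.
have xg t : 0 <= t <= 1 -> U (t *: v + q) ->
    gradient F (t *: v + q) = dotp (gradient F (t *: v + q)) m *: m.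
  move=> t01 Ux.
  have xm : dotp (t *: v + q) m = dotp q m by rewrite dotpDl dotpZl vm mulr0 add0r.
  have [b mE] : exists b, m = b *: gradient F (t *: v + q).
    apply: (orthogonal_colinear (g0 _ Ux)).
    apply: (maximizer_gradient WUF Ux (Wx _ t01)) => z Wz.
    by rewrite xm qmax// Wz.
  have b0 : b != 0.
    apply: contra_eq_neq m1 => b0.
    by rewrite mE b0 scale0r dotp0l eq_sym oner_eq0.
  have gE : gradient F (t *: v + q) = b^-1 *: m by rewrite mE scalerA mulVf// scale1r.
  by rewrite {2}gE dotpZl m1 mulr1.
have gq : gradient F q = dotp (gradient F q) m *: m.
  by have := xg 0; rewrite scale0r add0r lexx ler01; exact.
set k := dotp (gradient F q) m in gq.
have k0 : k != 0 by apply: contraNneq (g0 _ Uq) => k0; rewrite gq k0 scale0r.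
have cphi : {for q, continuous (fun x => k * dotp (gradient F x) m)}.
  apply: differentiable_continuous.
  apply: (@differentiableZ _ _ _ (fun x => dotp (gradient F x) m)).
  apply: differentiable_dotp; last exact: differentiable_cst.
  exact: (gradient_differentiable oU sF Uq).
have kk : 0 < k * k by rewrite -expr2 exprn_even_gt0.
have /nbhs_normP[r /= r0 hr] : \forall x \near q,
    0 < k * dotp (gradient F x) m /\ U x.
  apply: filterI; last exact: (open_nbhs_nbhs (conj oU Uq)).
  have hk : \forall x \near q, `|k * k - k * dotp (gradient F x) m| < k * k.
    exact: (cvgrPdist_lt _ _).1 cphi _ kk.
  by apply: filterS hk => x; rewrite ltr_norml => /andP[_]; lra.
have v1 : 0 < `|v| + 1 by rewrite ltr_wpDl.
(* On the segment the gradient is a multiple of [m], and near [q] this multiple keeps its sign, so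
   the unit gradient is the same one of [m] and [- m] as at [q]. *)
have NE t : 0 < t < Num.min (r / (`|v| + 1)) 1 ->
    unit_gradient F (t *: v + q) = unit_gradient F q.
  rewrite lt_min => /andP[t0 /andP[tr t1]].
  have [|kpos Ux] := hr (t *: v + q).
    rewrite /= opprD addrCA subrr addr0 normrN normrZ gtr0_norm//.
    rewrite (@le_lt_trans _ _ (t * (`|v| + 1)))// -?ltr_pdivlMr//.
    by rewrite ler_wpM2l ?lerDl// ltW.
  have /xg gx : 0 <= t <= 1 by rewrite !ltW.
  rewrite (unit_gradient_colinear m1 gq) (unit_gradient_colinear m1 (gx Ux)).
  by rewrite (sgr_eq_of_mul_gt0 kpos).
have dN := unit_gradient_differentiable oU sF Uq (g0 _ Uq).
have Dv : 'D_v (unit_gradient F) q = 0.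
  by rewrite deriveE//; apply: (diff_eq0_ray dN _ NE); rewrite lt_min divr_gt0 ?ltr01.
apply/eqP; rewrite -subr_eq0 -/v; apply/eqP.
by apply: (curvature_nondegenerate hWc WUF Uq Wq) => //; rewrite gq dotpZr vm mulr0.
Qed.

End wulff_shapes.

(** * Cross products and oriented normals *)

Lemma col_mx_rows {R : ringType} n (B : 'M[R]_(2, n)) : col_mx (row 0 B) (row 1 B) = B.
Proof.
apply/matrixP => i j; rewrite !mxE; case: splitP => k ik; rewrite mxE; congr (B _ _);
  by apply/val_inj; rewrite /= ik (ord1 k).
Qed.

Section cross_products.
Context {R : realType}.
Implicit Types (A : 'M[R]_(2, 3)) (v w m : 'rV[R]_3).

(** The usual cross product of the two rows. Cofactors along the last row do not see that row, so
    [0] is only a placeholder. *)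
Definition cross A : 'rV[R]_3 :=
  \row_j (cofactor (col_mx A 0 : 'M[R]_3) ord_max j).

Lemma dotp_cross v A : dotp v (cross A) = \det (col_mx A v : 'M[R]_3).
Proof.
rewrite dotpE (expand_det_row _ ord_max); apply: eq_bigr => j _.
rewrite mxE; congr (_ * _).
  rewrite [RHS]mxE; case: splitP => k /= kE; last by rewrite (ord1 k).
  by have := ltn_ord k; rewrite -kE ltnn.
rewrite /cofactor; congr (_ * \det _).
apply/matrixP => a b; rewrite !mxE; case: splitP => // k /=.
rewrite /bump leqNgt ltn_ord /= add0n => ak.
by have := ltn_ord a; rewrite ak -ltn_subRL subnn.
Qed.

Lemma Ck_cross (V : normedModType R) k (U : set V) (A : V -> 'M[R]_(2, 3)) :
  open U -> (forall i j, Ck_on k U (fun x => A x i j)) ->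
  Ck_on k U (fun x => cross (A x)).
Proof.
move=> oU hA.
have hM i j : Ck_on k U (fun x => (col_mx (A x) 0 : 'M[R]_3) i j).
  apply: (@Ck_eq R V R k U (fun x =>
    match fintype.split (i : 'I_(2 + 1)) with inl l => A x l j | inr _ => 0 end)) => //.
    by move=> x _; rewrite [RHS]mxE; case: (fintype.split _) => // l; rewrite mxE.
  by case: (fintype.split _) => l; [exact: hA|exact: Ck_cst].
apply: Ck_rV => // j.
pose h (x : V) : R := (-1) ^+ ((ord_max : 'I_3) + j) *
  \det (row' ord_max (col' j (col_mx (A x) 0 : 'M[R]_3))).
refine (@Ck_eq R V R k U h _ oU _ _); first by move=> x _; rewrite mxE.
apply: CkM => //; first exact: Ck_cst.
apply: Ck_det => // a b.
by apply: Ck_eq (hM (lift ord_max a) (lift j b)) => // x _; rewrite [RHS]mxE [RHS]mxE.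
Qed.

Variables (A : 'M[R]_(2, 3)) (m : 'rV[R]_3).
Hypotheses (m1 : dotp m m = 1) (Am : forall x : 'rV_2, dotp (x *m A) m = 0).
Hypothesis Apos : 0 < \det (col_mx A m : 'M[R]_3).

Lemma normal_complement w : dotp w m = 0 -> exists x, w = x *m A.
Proof.
have uM : (col_mx A m : 'M[R]_3) \in unitmx by rewrite unitmxE unitfE gt_eqF.
pose y : 'rV_(2 + 1) := w *m invmx (col_mx A m : 'M[R]_3).
have wE : w = lsubmx y *m A + rsubmx y *m m.
  by rewrite -mul_row_col hsubmxK /y (mulmxKV uM).
have yE : rsubmx y *m m = rsubmx y 0 0 *: m.
  by rewrite {1}[rsubmx y]mx11_scalar mul_scalar_mx.
move=> wm; exists (lsubmx y).
move: wm; rewrite {1}wE yE dotpDl Am add0r dotpZl m1 mulr1 => y0.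
by rewrite {1}wE yE y0 scale0r addr0.
Qed.

Lemma orthogonal_normal h : (forall x : 'rV_2, dotp (x *m A) h = 0) -> exists a, h = a *: m.
Proof.
move=> hA; apply: orthogonal_colinear; first by rewrite -dotp_gt0 m1.
by move=> w /normal_complement[x ->].
Qed.

(** The pairing of [cross A] with a vector of the plane is a determinant with dependent rows; the
    pairing with [m] is the positive determinant of the frame. Applied to tangent frames, this gives
    a smooth positive multiple of [nu], which itself is only given pointwise. *)
Lemma cross_normal : exists2 k, 0 < k & cross A = k *: m.
Proof.
have [|k kE] := @orthogonal_normal (cross A).
  move=> v; rewrite dotp_cross; apply/eqP/det0P; exists (row_mx v (- 1%:M) : 'rV[R]_(2 + 1)).
    apply/eqP => /(congr1 (@rsubmx _ 1 2 1)); rewrite row_mxKr.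
    by move=> /matrixP/(_ 0 0); rewrite !mxE => /eqP; rewrite oppr_eq0 oner_eq0.
  by apply: etrans (mul_row_col v (- 1%:M) A (v *m A)) _; rewrite mulNmx mul1mx subrr.
exists k => //; have := Apos.
by rewrite -dotp_cross kE dotpZr m1 mulr1.
Qed.

End cross_products.

(** Carries the normal and orientation conditions of [unit_normal], stated in the preferred chart,
    to another chart: [B] is the transition Jacobian, and its rows serve as [e1] and [e2]. *)
Lemma oriented_frame {R : realType} (A M : 'M[R]_(2, 3)) (B : 'M[R]_2) (m : 'rV[R]_3) :
  0 < \det B -> A = B *m M -> (forall v : 'rV_2, dotp (v *m M) m = 0) ->
  (forall e1 e2 : 'rV_2, 0 < \det (col_mx e1 e2 : 'M[R]_2) ->
    0 < \det (col_mx (col_mx (e1 *m M) (e2 *m M)) m : 'M[R]_3)) ->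
  (forall v : 'rV_2, dotp (v *m A) m = 0) /\ 0 < \det (col_mx A m : 'M[R]_3).
Proof.
move=> B0 -> Mm Mpos; split=> [v|]; first by rewrite mulmxA Mm.
have := Mpos (row 0 B) (row 1 B); rewrite col_mx_rows => /(_ B0).
by rewrite -!row_mul col_mx_rows.
Qed.

Lemma derive_comp_linear {R : realType} (V W Z : normedModType R)
  (L : {linear V -> W}) (g : W -> Z) z w : 'D_w (g \o L) z = 'D_(L w) g (L z).
Proof.
suff E : (fun h : R => h^-1 *: (((g \o L) \o shift z) (h *: w) - (g \o L) z)) =
    (fun h => h^-1 *: ((g \o shift (L z)) (h *: L w) - g (L z))) by rewrite /derive E.
by apply/funext => h /=; rewrite (linearD L) (linearZZ L).
Qed.

Lemma mulmx_inj_unit {R : fieldType} n (M : 'M[R]_n) :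
  (forall k : 'rV_n, k *m M = 0 -> k = 0) -> M \in unitmx.
Proof.
move=> Minj; rewrite unitmxE unitfE; apply/det0P => -[k k0 kM].
by move/eqP: k0; apply; exact: Minj.
Qed.

(* The zeros of [tangency_map] over [u] are the points of the surface [F = 0] whose
   tangent plane is parallel to the plane spanned by the rows of [A u]. *)
Section tangency.
Context {R : realType}.
Variables (V : set 'rV[R]_2) (A : 'rV[R]_2 -> 'M[R]_(2, 3)).
Variables (U : set 'rV[R]_3) (F : 'rV[R]_3 -> R).
Hypotheses (oV : open V) (oU : open U) (sF : smooth_on U F).
Hypothesis sA : forall k i j, Ck_on k V (fun u => A u i j).

Definition tangency_map (z : 'rV[R]_(2 + 3)) : 'rV[R]_(2 + 1) :=
  row_mx (\row_i dotp (row i (A (lsubmx z))) (gradient F (rsubmx z)))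
         (const_mx (F (rsubmx z))).

Definition tangency_dom : set 'rV[R]_(2 + 3) :=
  [set z | V (lsubmx z) /\ U (rsubmx z)].

Lemma tangency_dom_open : open tangency_dom.
Proof.
have ol : open ((lsubmx : 'rV[R]_(2 + 3) -> 'rV[R]_2) @^-1` V).
  by apply: open_comp => // z _; exact: continuous_lsubmx.
have or : open ((rsubmx : 'rV[R]_(2 + 3) -> 'rV[R]_3) @^-1` U).
  by apply: open_comp => // z _; exact: continuous_rsubmx.
exact: openI ol or.
Qed.

Lemma row_smooth k i : Ck_on k V (fun u => row i (A u)).
Proof. by apply: Ck_rV => // j; apply: Ck_eq (sA k i j) => // u _; rewrite mxE. Qed.

Lemma tangency_map_smooth : smooth_on tangency_dom tangency_map.
Proof.
move=> k; have oO := tangency_dom_open.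
have hl : Ck_on k tangency_dom (lsubmx : 'rV[R]_(2 + 3) -> _).
  by apply: Ck_linear => //; exact: continuous_lsubmx.
have hr : Ck_on k tangency_dom (rsubmx : 'rV[R]_(2 + 3) -> _).
  by apply: Ck_linear => //; exact: continuous_rsubmx.
apply: Ck_row_mx => //; apply: Ck_rV => // j.
  apply: (@Ck_eq _ _ _ k tangency_dom (fun z => \sum_l
    ((fun u => A u j l) \o lsubmx) z * ((fun y => gradient F y 0 l) \o rsubmx) z)) => //.
    by move=> z _; rewrite mxE dotpE; apply: eq_bigr => l _; rewrite mxE.
  apply: Ck_sum => // l _; apply: CkM => //.
    by apply: (Ck_comp oO oV _ hl) => // z [].
  apply: (Ck_comp oO oU _ hr); first by move=> z [].
  exact: (Ck_coord l oU (gradient_smooth oU sF k)).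
apply: (@Ck_eq _ _ _ k tangency_dom (F \o rsubmx)) => //.
  by move=> z _; rewrite mxE.
by apply: (Ck_comp oO oU _ hr) => // z [].
Qed.

Lemma tangency_map_eq0 u q : F q = 0 ->
  (forall i, dotp (row i (A u)) (gradient F q) = 0) -> tangency_map (row_mx u q) = 0.
Proof.
move=> Fq Ag; rewrite /tangency_map row_mxKl row_mxKr Fq.
rewrite (_ : \row_i _ = 0); first exact: row_mx0.
by apply/rowP => i; rewrite !mxE Ag.
Qed.

(** The block [dsubmx] differentiates in the space variable alone, that is, along [row_mx 0 k], so
    the frame [A] stays fixed and only [F] and its gradient are differentiated. *)
Lemma tangency_map_kernel z (k : 'rV[R]_3) : tangency_dom z ->
  k *m dsubmx ('J tangency_map z) = 0 ->
  dotp k (gradient F (rsubmx z)) = 0 /\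
  forall i, dotp (row i (A (lsubmx z))) ('D_k (gradient F) (rsubmx z)) = 0.
Proof.
move=> zO; have [Vz Uz] := zO.
have dG : differentiable tangency_map z by have [+ _] := tangency_map_smooth 1%N; exact.
have dF : differentiable F (rsubmx z) by have [+ _] := sF 1%N; exact.
set w : 'rV_(2 + 3) := row_mx 0 k => kM.
have wl : lsubmx w = 0 by exact: row_mxKl.
have wr : rsubmx w = k by exact: row_mxKr.
have {kM}dG0 j : 'D_w (fun y => tangency_map y 0 j) z = 0.
  rewrite (derive_coord _ _ dG) deriveE//.
  have -> : 'd tangency_map z w = 0.
    by apply: etrans (jacobian_row_mx _ z 0 k) _; rewrite kM mul0mx addr0.
  by rewrite mxE.
split=> [|i].
  have := dG0 (rshift 2 0).
  rewrite (_ : (fun _ => _) = F \o (rsubmx : 'rV[R]_(2 + 3) -> _)); last first.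
    by apply/funext => y; rewrite row_mxEr mxE.
  by rewrite derive_comp_linear /= wr deriveE// diff_gradient.
have := dG0 (lshift 1 i).
rewrite (_ : (fun _ => _) = (fun y => dotp (((fun u => row i (A u)) \o lsubmx) y)
    ((gradient F \o rsubmx) y))); last first.
  by apply/funext => y; rewrite row_mxEl mxE.
have dr : differentiable (fun u => row i (A u)) (lsubmx z).
  by have [+ _] := row_smooth 1 i; exact.
have dg := gradient_differentiable oU sF Uz.
rewrite derive_dotp; first last.
- by apply: differentiable_comp => //; exact: differentiable_rsubmx.
- by apply: differentiable_comp => //; exact: differentiable_lsubmx.
by rewrite !derive_comp_linear /= wl wr derive0 dotp0l add0r.
Qed.

End tangency.

(** * The Cahn-Hoffman field *)

Section charts.
Context {R : realType} {S : orientedSurface R}.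
Variables (c : chart R S) (ca : atlas c).

Lemma param_continuous_at u : cod c u -> {for u, continuous (param c)}.
Proof.
move=> cu; have := param_continuous (c := c).
rewrite continuous_open_subspace; last exact: cod_open.
by apply; rewrite inE.
Qed.

Lemma overlap_nbhs u : cod c u ->
  \forall u' \near u, overlap c (chart_at (param c u)) u'.
Proof.
move=> cu; apply: filterI; first exact: (open_nbhs_nbhs (conj (@cod_open _ _ c) cu)).
apply: (param_continuous_at cu).
by apply: (open_nbhs_nbhs (conj (@dom_open _ _ _) _)); exact: chart_at_dom.
Qed.

Lemma param_transition u' c' : overlap c c' u' ->
  param c' (transition c c' u') = param c u'.
Proof. by move=> [_ /coordK]. Qed.

Lemma transition_unit u : cod c u ->
  0 < \det ('J (transition c (chart_at (param c u))) u).
Proof.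
move=> cu; apply: transition_oriented => //; first exact: chart_at_atlas.
exact: (nbhs_singleton (overlap_nbhs cu)).
Qed.

(** Chain rule through the preferred chart at [param c u]. It links the pointwise data in [diff_at]
    to derivatives in the fixed chart [c], where smoothness is tested. *)
Lemma jacobian_param n (f : S -> 'rV[R]_n) u : smooth_map f -> cod c u ->
  'J (f \o param c) u = 'J (transition c (chart_at (param c u))) u *m diff_at f (param c u).
Proof.
move=> sf cu; set p := param c u; set c' := chart_at p.
have ov : overlap c c' u by exact: (nbhs_singleton (overlap_nbhs cu)).
have c'a : atlas c' by exact: chart_at_atlas.
have dtr : differentiable (transition c c') u.
  by have [+ _] := transition_smooth ca c'a 1%N; exact.
have dfc' : differentiable (f \o param c') (transition c c' u).
  have [+ _] := sf _ c'a 1%N; apply; apply: coord_cod; exact: chart_at_dom.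
have fE : \near u, ((f \o param c') \o transition c c') u = (f \o param c) u.
  by apply: filterS (overlap_nbhs cu) => y yo /=; rewrite param_transition.
apply: etrans (esym (near_eq_jacobian fE (differentiable_comp dtr dfc'))) _.
exact: jacobian_comp.
Qed.

End charts.

Section cahn_hoffman_smooth.
Context {R : realType}.
Variables (T : 'rV[R]_3 -> R) (hT : is_norm T) (hWs : smooth_surface (wulff T)).
Variables (hWc : positive_curvature (wulff T)) (S : orientedSurface R).
Variables (X nu xi : S -> 'rV[R]_3) (hX : immersion X) (hnu : unit_normal X nu).
Variable hxi : cahn_hoffman T nu xi.

Section in_chart.
Variables (c : chart R S) (ca : atlas c).

Let A u := 'J (X \o param c) u.

Lemma chart_normal u : cod c u ->
  [/\ dotp (nu (param c u)) (nu (param c u)) = 1,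
      forall v : 'rV_2, dotp (v *m A u) (nu (param c u)) = 0
    & 0 < \det (col_mx (A u) (nu (param c u)) : 'M[R]_3)].
Proof.
move=> cu; have [n1 n0 npos] := hnu (param c u).
have [A0 Apos] := oriented_frame (transition_unit ca cu) (jacobian_param ca hX.1 cu) n0 npos.
by split.
Qed.

Lemma cross_chart_smooth k : Ck_on k (cod c) (fun u => cross (A u)).
Proof.
have oc : open (cod c) by exact: cod_open.
by apply: Ck_cross => // i j; apply: Ck_jacobian => //; exact: hX.1.
Qed.

Lemma xi_param_continuous u : cod c u -> {for u, continuous (xi \o param c)}.
Proof.
move=> cu; have oc : open (cod c) by exact: cod_open.
have Tle p : T (xi p) <= 1 by have [+ _] := hxi p; rewrite /wulff /= => ->.
have crossE u' : cod c u' -> exists2 k, 0 < k & cross (A u') = k *: nu (param c u').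
  by move=> /chart_normal[n1 An npos]; exact: cross_normal.
(* The cross product of the coordinate vectors replaces [nu]: it is visibly continuous, and being a
   positive multiple of [nu] it has the same maximizers. *)
apply: (@argmax_continuous _ _ _ [set x | T x <= 1] (fun u => cross (A u))).
- exact: norm_unit_ball_closed.
- by move=> x y t Tx Ty t01; exact: (norm_unit_ball_convex hT).
- exact: (cross_chart_smooth 0).
- apply: filterS (open_nbhs_nbhs (conj oc cu)) => u' /crossE[k k0 ->].
  split=> [|y Ty]; first exact: Tle.
  rewrite !dotpZr ler_pM2l//; have [Wq qm] := hxi (param c u').
  exact: (outward_normal_max hT hWs Wq qm).
- move=> y Ty; have [k k0 ->] := crossE _ cu; rewrite !dotpZr => yE.
  have [Wq qm] := hxi (param c u).
  apply: (outward_normal_max_unique hT hWs hWc Wq qm Ty).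
  exact: (mulfI (lt0r_neq0 k0) yE).
Qed.

Lemma xi_param_smooth : smooth_on (cod c) (xi \o param c).
Proof.
move=> k; have oc : open (cod c) by exact: cod_open.
apply: Ck_local => u cu.
have [Wu _] := hxi (param c u); have [U [F [WUF Uu]]] := hWs Wu.
have [oU sF WF g0] := WUF.
pose U0 := cod c `&` (xi \o param c) @^-1` U.
have oU0 : open U0.
  rewrite openE => u' [cu' Uu']; apply: filterI; first exact: (open_nbhs_nbhs (conj oc cu')).
  exact: (xi_param_continuous cu' (open_nbhs_nbhs (conj oU Uu'))).
have sA k' i j : Ck_on k' (cod c) (fun u => A u i j).
  by apply: Ck_jacobian => //; exact: hX.1.
exists U0 => //.
apply: (@implicit_smooth _ 2 3 _ (tangency_map A F) U0 (tangency_dom (cod c) U)).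
- exact: oU0.
- exact: tangency_dom_open.
- exact: tangency_map_smooth.
- by move=> u' [cu' _]; exact: xi_param_continuous.
- by move=> u' [cu' Uu']; split; rewrite ?row_mxKl ?row_mxKr.
- move=> u' [cu' Uu']; have [Wu' nu'] := hxi (param c u').
  have [a _ gE] := outward_normal_gradient WUF Uu' nu'.
  have [_ An _] := chart_normal cu'.
  apply: tangency_map_eq0; first exact: (WF _ Uu').1.
  by move=> l; rewrite gE dotpZr rowE An mulr0.
- move=> u' [cu' Uu']; apply: mulmx_inj_unit => w wM.
  have zO : tangency_dom (cod c) U (row_mx u' (xi (param c u'))).
    by split; rewrite ?row_mxKl ?row_mxKr.
  have [] := tangency_map_kernel oc oU sF sA zO wM.
  rewrite row_mxKl row_mxKr => wg wD.
  have [Wu' nu'] := hxi (param c u').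
  have [a a0 gE] := outward_normal_gradient WUF Uu' nu'.
  have [n1 An npos] := chart_normal cu'.
  (* For [w] in the kernel, the derivative of the gradient along [w] is orthogonal to the tangent
     plane, hence parallel to the gradient. The unit gradient is then stationary along the tangent
     vector [w], and curvature forces [w = 0]. *)
  have [|b DE] := orthogonal_normal n1 An npos (h := 'D_w (gradient F) (xi (param c u'))).
    by move=> x; rewrite dotp_mulmx big1// => i _; rewrite wD mulr0.
  apply: (curvature_nondegenerate hWc WUF Uu' Wu' wg).
  apply: (unit_gradient_derive_eq0 oU sF g0 Uu' (c := b / a)).
  by rewrite DE gE scalerA divfK.
Qed.

End in_chart.

Lemma cahn_hoffman_smooth : smooth_map xi.
Proof. by move=> c ca; exact: xi_param_smooth. Qed.

(* Near [p], [nu] is a fixed sign times the unit gradient at [xi]; the sign is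
   detected by [<xi, nu> > 0]. *)
Lemma cahn_hoffman_immersion p (e : 'rV[R]_2) : nonvanishing_curvature X nu ->
  e *m diff_at xi p = 0 -> e = 0.
Proof.
move=> hK; set c := chart_at p; set u := Defs.coord c p.
have ca : atlas c by exact: chart_at_atlas.
have cu : cod c u by apply: coord_cod; exact: chart_at_dom.
have oc : open (cod c) by exact: cod_open.
have pE : param c u = p by apply: coordK; exact: chart_at_dom.
pose f := xi \o param c; pose h := nu \o param c.
have df : differentiable f u by have [+ _] := cahn_hoffman_smooth ca 1%N; exact.
have [Wp _] := hxi p; have [U [F [WUF Up]]] := hWs Wp.
have [oU sF WF g0] := WUF.
have Uu : U (f u) by rewrite /f /= pE.
pose N := unit_gradient F.
have dN : differentiable N (f u) by apply: (unit_gradient_differentiable oU sF Uu); exact: g0.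
have dNf : differentiable (N \o f) u by exact: differentiable_comp.
pose phi y := dotp (f y) ((N \o f) y).
have cphi : {for u, continuous phi}.
  by apply: differentiable_continuous; exact: differentiable_dotp.
have NE y : U (f y) -> exists2 a, a != 0 &
    N (f y) = Num.sg a *: h y /\ Num.sg (phi y) = Num.sg a.
  move=> Uy; have [Wy ny] := hxi (param c y).
  have [a a0 gE] := outward_normal_gradient WUF Uy ny.
  have [n1 _ _] := ny; exists a => //.
  have NfE : N (f y) = Num.sg a *: h y by exact: unit_gradient_colinear.
  split=> //; rewrite /phi /= NfE dotpZr sgrM sgr_id.
  by rewrite (gtr0_sg (outward_normal_pos hT hWs Wy ny)) mulr1.
have phi0 : phi u != 0.
  by have [a a0 [_ sE]] := NE _ Uu; rewrite -sgr_eq0 sE sgr_eq0.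
have hE : \forall y \near u, (Num.sg (phi u) *: (N \o f)) y = h y.
  have nphi : \forall y \near u, 0 < phi u * phi y.
    have pp : 0 < `|phi u| by rewrite normr_gt0.
    have hp : \forall y \near u, `|phi u - phi y| < `|phi u|.
      exact: (cvgrPdist_lt _ _).1 cphi _ pp.
    by apply: filterS hp => y; exact: mul_gt0_of_dist_lt.
  have nU : \forall y \near u, U (f y).
    exact: (differentiable_continuous df (open_nbhs_nbhs (conj oU Uu))).
  apply: filterS2 nphi nU => y /sgr_eq_of_mul_gt0 sE /NE[a a0 [NfE phE]].
  rewrite scalrfctE sE phE; apply: etrans (congr1 _ NfE) _.
  by rewrite scalerA -expr2 sqr_sg a0 scale1r.
have dh : differentiable h u.
  by apply: (near_eq_differentiable hE); exact: differentiableZ.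
move=> exi.
have De : 'D_e h u = 0.
  rewrite -(near_eq_derive e hE) deriveZ; last exact: diff_derivable.
  rewrite deriveE// (congr1 (fun G : 'rV[R]_2 -> 'rV[R]_3 => G e) (diff_comp df dN)) /=.
  have -> : 'd f u e = 0 by apply: etrans (esym (jacobianP f u e)) exi.
  by rewrite linear0 scaler0.
have eh : e *m diff_at nu p = 0 :=
  etrans (jacobianP h u e) (etrans (esym (deriveE e dh)) De).
apply/eqP/negPn/negP => e0; have := hK p.
by rewrite (gauss_curvature_eq0 (diff_at X p) e0 eh) eqxx.
Qed.

End cahn_hoffman_smooth.

(** * The trace condition *)

Section trace_algebra.
Context {R : realType}.
Implicit Types (A D : 'M[R]_(2, 3)) (M : 'M[R]_2).

(** [M] is the matrix of [(dxi)^-1 dX] on the parameter plane. In the basis [e1, e2] it is diagonal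
    with entries [- 1/l1] and [- 1/l2], so it is obtained by conjugating a diagonal matrix. *)
Lemma curvature_matrix A D (e1 e2 : 'rV[R]_2) (l1 l2 : R) :
  row_free (col_mx e1 e2) -> l1 != 0 -> l2 != 0 ->
  e1 *m D = - l1 *: (e1 *m A) -> e2 *m D = - l2 *: (e2 *m A) ->
  exists2 M, A = M *m D & \tr M = - (l1^-1 + l2^-1).
Proof.
set P : 'M[R]_2 := col_mx e1 e2 => fP l10 l20 D1 D2.
have uP : P \in unitmx by rewrite -row_free_unit.
pose Q : 'M[R]_2 := block_mx (- l1^-1)%:M 0 0 (- l2^-1)%:M : 'M[R]_(1 + 1).
have QP : Q *m (P *m D) = P *m A.
  apply: etrans (congr1 (mulmx Q) (mul_col_mx e1 e2 D)) _.
  apply: etrans (mul_block_col ((- l1^-1)%:M : 'M[R]_1) 0 0 ((- l2^-1)%:M : 'M[R]_1)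
    (e1 *m D) (e2 *m D)) _.
  rewrite !mul0mx addr0 add0r !mul_scalar_mx D1 D2 !scalerA !mulrNN !mulVf// !scale1r.
  exact: (esym (mul_col_mx e1 e2 A)).
exists (invmx P *m Q *m P); first by rewrite -!mulmxA QP mulKmx.
rewrite -mulmxA mxtrace_mulC -mulmxA mulmxV// mulmx1.
apply: etrans (mxtrace_block ((- l1^-1)%:M : 'M[R]_1) 0 0 ((- l2^-1)%:M : 'M[R]_1)) _.
by rewrite !mxtrace_scalar !mulr1n opprD.
Qed.

(** Since [A = M *m D], the matrix [M] inverts [L = endo_mx A D], and [(1 + r L) L^-1 = M + r]; the
    factor 2 is the dimension of the plane. *)
Lemma trace_endo_mx A D M (r : R) : row_free A -> A = M *m D ->
  \tr (endo_mx A (A + r *: D) *m invmx (endo_mx A D)) = \tr M + 2 * r.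
Proof.
move=> fA AE; rewrite /endo_mx; set L := D *m pinvmx A.
have ML : M *m L = 1%:M by rewrite mulmxA -AE mulmxVp.
have [uM uL] := mulmx1_unit ML.
have -> : invmx L = M by rewrite -[RHS]mulmx1 -(mulmxV uL) mulmxA ML mul1mx.
rewrite mulmxDl mulmxVp// -scalemxAl -/L mulmxDl mul1mx -scalemxAl (mulmx1C ML).
by rewrite mxtraceD mxtraceZ mxtrace1 mulrC.
Qed.

Lemma gram_unit D : (forall k : 'rV[R]_2, k *m D = 0 -> k = 0) -> D *m D^T \in unitmx.
Proof.
move=> Dinj; apply: mulmx_inj_unit => k kD; apply: Dinj.
apply/eqP; rewrite -dotp_eq0 /dotp trmx_mul !mulmxA -(mulmxA k) kD.
by rewrite mul0mx mxE.
Qed.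

(** A change of chart conjugates [M] by [B], and [D'^T (D' D'^T)^-1] is a right inverse of [D']
    whose entries are rational in those of [D']. The trace thus becomes a smooth function of the
    derivatives in a fixed chart. *)
Lemma trace_gram A D M (B : 'M[R]_2) A' D' : B \in unitmx ->
  A' = B *m A -> D' = B *m D -> A = M *m D ->
  (forall k : 'rV[R]_2, k *m D = 0 -> k = 0) ->
  D' *m D'^T \in unitmx /\ \tr M = \tr (A' *m D'^T *m invmx (D' *m D'^T)).
Proof.
move=> uB A'E D'E AE Dinj.
have uG : D' *m D'^T \in unitmx.
  apply: gram_unit => k; rewrite D'E mulmxA => /Dinj kB.
  by rewrite -(mulmxK uB k) kB mul0mx.
have -> : A' = (B *m M *m invmx B) *m D'.
  by rewrite A'E D'E AE -!mulmxA mulKmx.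
by split=> //; rewrite -[X in X *m invmx _]mulmxA mulmxK// mxtrace_mulC mulKmx.
Qed.

Lemma row_free_col_mx_neq0 (e1 e2 : 'rV[R]_2) :
  row_free (col_mx e1 e2) -> e1 != 0 /\ e2 != 0.
Proof.
move=> fP; have inj (a b : 'M[R]_1) : a *m e1 + b *m e2 = 0 -> a = 0 /\ b = 0.
  rewrite -mul_row_col => /eqP; rewrite (mulmx_free_eq0 _ fP) => /eqP ab0.
  have := congr1 rsubmx ab0; have := congr1 lsubmx ab0.
  by rewrite row_mxKl row_mxKr !linear0.
split; apply/eqP => e0.
  have [] := inj 1%:M 0; first by rewrite e0 mulmx0 mul0mx addr0.
  by move=> /matrixP/(_ 0 0)/eqP; rewrite !mxE oner_eq0.
have [] := inj 0 1%:M; first by rewrite e0 mulmx0 mul0mx addr0.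
by move=> _ /matrixP/(_ 0 0)/eqP; rewrite !mxE oner_eq0.
Qed.

Lemma horizontal_part (P : 'M[R]_(2, 3 + 1)) A D (s : 'rV[R]_2 -> R) (r : R) (q : 'rV[R]_3) :
  (forall e : 'rV[R]_2,
    e *m P = row_mx (e *m A + (s e *: q + r *: (e *m D))) (const_mx (s e))) ->
  lsubmx P - rsubmx P *m q = A + r *: D.
Proof.
move=> PE; apply/row_matrixP => i; rewrite [LHS]rowE [RHS]rowE.
rewrite mulmxBr mulmxA mulmx_lsub mulmx_rsub PE row_mxKl row_mxKr.
rewrite (_ : const_mx _ = (s (delta_mx 0 i))%:M); last first.
  by apply/rowP => j; rewrite (ord1 j) !mxE eqxx mulr1n.
by rewrite mul_scalar_mx mulmxDr -scalemxAr addrCA addrAC subrr add0r.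
Qed.

End trace_algebra.

Lemma Ck_trace_gram {R : realType} (V : normedModType R) k (U : set V)
    (A D : V -> 'M[R]_(2, 3)) : open U ->
  (forall i j, Ck_on k U (fun x => A x i j)) ->
  (forall i j, Ck_on k U (fun x => D x i j)) ->
  (forall x, U x -> D x *m (D x)^T \in unitmx) ->
  Ck_on k U (fun x => \tr (A x *m (D x)^T *m invmx (D x *m (D x)^T))).
Proof.
move=> oU sA sD uG.
have sDT i j : Ck_on k U (fun x => (D x)^T i j).
  by apply: Ck_eq (sD j i) => // x _; rewrite mxE.
apply: Ck_sum => // i _; apply: Ck_mulmx => // a b; first exact: Ck_mulmx.
by apply: Ck_invmx => // c d; exact: Ck_mulmx.
Qed.

(** * Differential of a sphere congruence *)

Section differential_of_congruence.
Context {R : realType} {V : normedModType R}.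

Lemma differentiable_scale n (r : V -> R) (g : V -> 'rV[R]_n) x :
  differentiable r x -> differentiable g x -> differentiable (fun y => r y *: g y) x.
Proof.
move=> dr dg; apply: (differentiable_rVP _ _).2 => j.
rewrite (_ : (fun _ => _) = r * (fun y => g y 0 j)).
  by apply: differentiableM => //; exact: (differentiable_rVP g x).1.
by apply/funext => y; rewrite mxE.
Qed.

Lemma derive_scale n (r : V -> R) (g : V -> 'rV[R]_n) x v :
  differentiable r x -> differentiable g x ->
  'D_v (fun y => r y *: g y) x = 'D_v r x *: g x + r x *: 'D_v g x.
Proof.
move=> dr dg; apply/rowP => j.
rewrite -(derive_coord _ _ (differentiable_scale dr dg)).
rewrite (_ : (fun _ => _) = r * (fun y => g y 0 j)); last first.
  by apply/funext => y; rewrite mxE.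
have dgj : derivable (fun y => g y 0 j) x v.
  by apply: diff_derivable; exact: (differentiable_rVP g x).1.
rewrite (deriveM (diff_derivable dr) dgj).
rewrite (derive_coord _ _ dg) addrC [RHS]mxE !(mxE _ _ 0 j) /GRing.scale /=.
by rewrite [g x 0 j * _]mulrC.
Qed.

Lemma congruence_diff (f g : V -> 'rV[R]_3) (r : V -> R) x v :
  let Y y : 'rV[R]_(3 + 1) :=
    row_mx (f y) (const_mx 0) + r y *: row_mx (g y) (const_mx 1) in
  differentiable f x -> differentiable g x -> differentiable r x ->
  differentiable Y x /\
  'D_v Y x = row_mx ('D_v f x + ('D_v r x *: g x + r x *: 'D_v g x))
                    (const_mx ('D_v r x)).
Proof.
move=> Y df dg dr; rewrite /Y {Y}.
pose fg y := f y + r y *: g y; pose r1 y : 'rV[R]_1 := const_mx (r y).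
have -> : (fun y => row_mx (f y) (const_mx 0) + r y *: row_mx (g y) (const_mx 1)) =
    fun y => row_mx (fg y) (r1 y).
  apply/funext => y; rewrite scale_row_mx add_row_mx; congr row_mx.
  by apply/rowP => j; rewrite !mxE add0r mulr1.
have dfg : differentiable fg x.
  by apply: differentiableD => //; exact: differentiable_scale.
have dr1 : differentiable r1 x.
  apply: (differentiable_rVP _ _).2 => j.
  by rewrite (_ : (fun _ => _) = r)//; apply/funext => y; rewrite mxE.
have dh := differentiable_row_mx dfg dr1.
split=> //; rewrite deriveE//; apply: etrans (diff_row_mx _ dfg dr1) _.
congr row_mx.
  rewrite -deriveE// deriveD; [|exact: diff_derivable|]; last first.
    by apply: diff_derivable; exact: differentiable_scale.
  by rewrite (derive_scale _ dr dg).
rewrite -deriveE//; apply/rowP => j; rewrite -(derive_coord _ _ dr1) [RHS]mxE.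
by rewrite (_ : (fun _ => _) = r)//; apply/funext => y; rewrite mxE.
Qed.

End differential_of_congruence.

Lemma horizontal_diff_sphere_map {R : realType} (S : orientedSurface R)
    (X xi : S -> 'rV[R]_3) (rho : S -> R) p :
  smooth_map X -> smooth_map xi -> smooth_map rho ->
  horizontal_diff_at xi (sphere_map X xi rho) p = diff_at X p + rho p *: diff_at xi p.
Proof.
move=> sX sxi srho; set c := chart_at p; set u := Defs.coord c p.
have ca : atlas c by exact: chart_at_atlas.
have cu : cod c u by apply: coord_cod; exact: chart_at_dom.
have pE : param c u = p by apply: coordK; exact: chart_at_dom.
have df : differentiable (X \o param c) u by have [+ _] := sX _ ca 1%N; exact.
have dg : differentiable (xi \o param c) u by have [+ _] := sxi _ ca 1%N; exact.
have dr : differentiable (rho \o param c) u by have [+ _] := srho _ ca 1%N; exact.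
have dh v := congruence_diff v df dg dr.
have rE : (rho \o param c) u = rho p by rewrite /= pE.
have gE : (xi \o param c) u = xi p by rewrite /= pE.
rewrite /horizontal_diff_at.
apply: (@horizontal_part _ _ _ _ (fun e => 'D_e (rho \o param c) u)) => e.
have [dhu hE] := dh e.
have PE : e *m diff_at (sphere_map X xi rho) p = _ :=
  etrans (jacobianP _ u e) (etrans (esym (deriveE e dhu)) hE).
have XE : e *m diff_at X p = 'D_e (X \o param c) u :=
  etrans (jacobianP _ u e) (esym (deriveE e df)).
have xiE : e *m diff_at xi p = 'D_e (xi \o param c) u :=
  etrans (jacobianP _ u e) (esym (deriveE e dg)).
apply: etrans PE _; congr (row_mx _ _).
apply: etrans (congr2
  (fun a b => a + ('D_e (rho \o param c) u *: xi p + rho p *: b))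
  (esym XE) (esym xiE)).
by rewrite rE gE.
Qed.

Theorem lemma3p3 (R : realType) (T : 'rV[R]_3 -> R)
    (hT : is_norm T)
    (hWs : smooth_surface (wulff T))
    (hWc : positive_curvature (wulff T))
    (S : orientedSurface R) (X nu xi : S -> 'rV[R]_3)
    (hX : immersion X)
    (hnu : unit_normal X nu)
    (hK : nonvanishing_curvature X nu)
    (hxi : cahn_hoffman T nu xi)
    (lambda1 lambda2 : S -> R)
    (hlambda : anisotropic_principal_curvatures X xi lambda1 lambda2) :
  anisotropic_sphere_congruence X xi
    (middle_sphere_congruence X xi lambda1 lambda2) /\
  forall Y : S -> 'rV[R]_(3 + 1), anisotropic_sphere_congruence X xi Y ->
    ((forall p : S, congruence_trace X xi Y p = 0) <->
     Y = middle_sphere_congruence X xi lambda1 lambda2).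
Proof.
have sxi : smooth_map xi := cahn_hoffman_smooth hT hWs hWc hX hnu hxi.
have xi_inj p (e : 'rV[R]_2) : e *m diff_at xi p = 0 -> e = 0.
  exact: (cahn_hoffman_immersion hT hWs hWc hX hnu hxi hK).
have hM p : exists2 M, diff_at X p = M *m diff_at xi p &
    \tr M = - ((lambda1 p)^-1 + (lambda2 p)^-1).
  have [e1 [e2 [fe D1 D2]]] := hlambda p.
  have [e10 e20] := row_free_col_mx_neq0 fe.
  apply: (curvature_matrix fe _ _ D1 D2).
    by apply: contraNneq e10 => l0; rewrite (xi_inj p e1)// D1 l0 oppr0 scale0r.
  by apply: contraNneq e20 => l0; rewrite (xi_inj p e2)// D2 l0 oppr0 scale0r.
pose rho0 p := 2^-1 * ((lambda1 p)^-1 + (lambda2 p)^-1).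
have srho0 : smooth_map rho0.
  move=> c ca k; have oc : open (cod c) by exact: cod_open.
  pose A u := 'J (X \o param c) u; pose D u := 'J (xi \o param c) u.
  have sA i j : Ck_on k (cod c) (fun u => A u i j) by apply: Ck_jacobian => //; exact: hX.1.
  have sD i j : Ck_on k (cod c) (fun u => D u i j) by apply: Ck_jacobian => //; exact: sxi.
  have hu u : cod c u -> D u *m (D u)^T \in unitmx /\
      rho0 (param c u) = - 2^-1 * \tr (A u *m (D u)^T *m invmx (D u *m (D u)^T)).
    move=> cu; have [M AE trM] := hM (param c u).
    have uB : 'J (transition c (chart_at (param c u))) u \in unitmx.
      by rewrite unitmxE unitfE gt_eqF//; exact: transition_unit.
    have [uG trG] := trace_gram uB (jacobian_param ca hX.1 cu)
      (jacobian_param ca sxi cu) AE (xi_inj _).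
    split; first exact: uG.
    by rewrite -[X in _ * X]trG trM mulNr mulrN opprK.
  have str := Ck_trace_gram oc sA sD (fun u cu => (hu u cu).1).
  apply: Ck_eq (CkM oc (Ck_cst k (- 2^-1 : R) oc) str) => // u cu.
  exact: esym (hu u cu).2.
have traceE rho p : smooth_map rho ->
    congruence_trace X xi (sphere_map X xi rho) p = 2 * (rho p - rho0 p).
  move=> srho; have [M AE trM] := hM p.
  rewrite /congruence_trace (horizontal_diff_sphere_map p hX.1 sxi srho).
  rewrite (trace_endo_mx _ (hX.2 p) AE) trM /rho0.
  by move: (_ + _^-1) => a; field.
split; first by exists rho0.
move=> Y [rho [srho ->]]; split=> [tr0|YE p].
  congr sphere_map; apply/funext => p; apply/eqP; rewrite -subr_eq0.
  by have /eqP := tr0 p; rewrite traceE// mulf_eq0 pnatr_eq0.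
(* The last coordinate of [sphere_map] is the radius, so a congruence determines its radius
   function. *)
have rhoE : rho p = rho0 p.
  have := congr1 (fun Z : S -> 'rV[R]_(3 + 1) => rsubmx (Z p) 0 0) YE.
  rewrite /middle_sphere_congruence /sphere_map !scale_row_mx !add_row_mx !row_mxKr !mxE.
  by rewrite !add0r !mulr1.
by rewrite traceE// rhoE subrr mulr0.
Qed.
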